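(* Let $\mathcal{C}=(V,\mathcal{R})$ be a coherent configuration with exactly two fibers $X$ and $Y$, and suppose that $|X|=|Y|$ is a prime, $|\mathcal{R}_{X,X}|>2$ and $|\mathcal{R}_{X,Y}|>1$. Put $k=\frac{|X|-1}{|\mathcal{R}_{X,X}|-1}$. Then there exists $R\in\mathcal{R}_{X,Y}$ with $|R|=|X|=|Y|$ provided one of the following holds: (i) $|\mathcal{R}_{X,X}|>k^2(k+e-2)$, where $e$ is the number of distinct prime divisors of $k$; (ii) $k\in\{q,2q,3q\}$ for some prime power $q$; (iii) $k=4q$ for some prime power $q$ with $3\nmid q+1$.
   Context: A coherent configuration is a pair $\mathcal{C}=(V,\mathcal{R})$ where $V$ is a finite set and $\mathcal{R}$ is a partition of $V\times V$ into nonempty sets such that: (1) the diagonal $\Delta_V=\{(v,v)\mid v\in V\}$ is a union of members of $\mathcal{R}$; (2) for each $R\in\mathcal{R}$ its transpose $R^t=\{(u,v)\mid (v,u)\in R\}$ belongs to $\mathcal{R}$; (3) for all $R,S,T\in\mathcal{R}$ there is a constant $c_{RS}^T$ with $c_{RS}^T=|R(u)\cap S^t(v)|$ for all $(u,v)\in T$, where $T(w)=\{z\in V\mid (w,z)\in T\}$. A subset $X\subseteq V$ is a fiber if $\Delta_X=\{(x,x)\mid x\in X\}\in\mathcal{R}$. For fibers $X,Y$, $\mathcal{R}_{X,Y}=\{R\in\mathcal{R}\mid R\subseteq X\times Y\}$. *)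

(* Defs.v *)
From mathcomp Require Import all_boot all_order all_algebra.
Set Implicit Arguments. Unset Strict Implicit. Unset Printing Implicit Defensive.

Definition diag_set (V : finType) (X : {set V}) : {set V * V} :=
  [set (x, x) | x in X].

Definition transpose_rel (V : finType) (R : {set V * V}) : {set V * V} :=
  [set (u.2, u.1) | u in R].

Definition coherent_configuration (V : finType) (Rel : {set {set V * V}}) : Prop :=
  [/\ partition Rel [set: V * V],
      (exists S : {set {set V * V}}, S \subset Rel /\ cover S = diag_set [set: V]),
      (forall R, R \in Rel -> transpose_rel R \in Rel) &
      (forall R S T, R \in Rel -> S \in Rel -> T \in Rel ->
         exists c : nat, forall u v, (u, v) \in T ->
           #|[set z | ((u, z) \in R) && ((z, v) \in S)]| = c)].

Definition fiber (V : finType) (Rel : {set {set V * V}}) (X : {set V}) : bool :=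
  diag_set X \in Rel.

Definition rels_between (V : finType) (Rel : {set {set V * V}}) (X Y : {set V})
  : {set {set V * V}} :=
  [set R in Rel | R \subset setX X Y].

Definition prime_power (q : nat) : Prop :=
  exists p n : nat, prime p /\ (0 < n)%N /\ q = (p ^ n)%N.

(* Main.v *)
Require Import Defs.
From mathcomp Require Import all_boot all_order all_algebra all_field spectral.
From mathcomp Require Import ring zify.
Set Implicit Arguments. Unset Strict Implicit. Unset Printing Implicit Defensive.
Import Order.TTheory GRing.Theory Num.Theory.

(** Let p = |X|.  The trace of every matrix in the adjacency algebra of X is
    divisible by p, so modulo p this algebra has no idempotents except 0 and 1,
    and an element is invertible as soon as its valency is prime to p.  Hence all
    relations between X and Y are invertible modulo p, and there are as many of
    them as relations on X.  Comparing the standard and regular traces modulo p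
    shows moreover that all nondiagonal relations on X and Y have valency k, and
    that B_j acts with trace k - 1 on the span of the relations between X and Y.

    The theorem is then arithmetic in the valencies r_R of the relations A_R
    between X and Y.  Counting valencies in A_R A_R^T and A_R^T A_S gives
    k | r_R (r_R - 1) and k | r_R r_S, so each prime divisor of k is prime to
    exactly one r_R, and all but at most e of the r_R are multiples of k.  The
    trace identity
      tr (A_R A_R^T A_S A_S^T) = tr (A_R^T A_S (A_R^T A_S)^T)
    together with the divisibility by r_R / gcd (r_R, k) of the coefficients of
    A_R^T A_S is very restrictive.  In case (i) it can be applied to an S for which
    A_R A_R^T and A_S A_S^T share no nondiagonal relation, and then r_R | k; this
    for all R forces some r_R = 1, since the r_R sum to |X|.  In cases (ii) and
    (iii) there are at most two r_R that are not multiples of k, and it excludes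
    that there are two. *)

(** * Traces *)

Section Traces.

Local Open Scope ring_scope.

(** In a full-rank factorization e = C R, idempotence gives R C = 1, an identity matrix of size
    [\rank e]; then tr (C R) = tr (R C). *)
Lemma mxtrace_idem (F : fieldType) n (e : 'M[F]_n) :
  e *m e = e -> \tr e = (\rank e)%:R.
Proof.
move=> ee; have RC : row_base e *m col_base e = 1%:M.
  apply: (row_free_inj (row_base_free e)); rewrite mul1mx.
  have /row_fullP[C' C'K] := col_base_full e.
  have C'e : C' *m e = row_base e.
    by rewrite -[X in _ *m X](mulmx_base e) mulmxA C'K mul1mx.
  by rewrite -mulmxA mulmx_base -C'e -mulmxA ee.
by rewrite -[X in \tr X](mulmx_base e) mxtrace_mulC RC mxtrace1.
Qed.

(** Induction on the size: for M = C R of full-rank factors, R C has the same trace, is again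
    nilpotent, and is smaller unless M is invertible, which forces size 0. *)
Lemma mxtrace_nilp (F : fieldType) n (M : 'M[F]_n) e : M ^+ e = 0 -> \tr M = 0.
Proof.
elim/ltn_ind: n M e => n IHn M e.
have [rM|rM] := ltnP (\rank M) n; last first.
  have uM : M \in unitmx by rewrite -row_full_unit /row_full eqn_leq rank_leq_col.
  have: M ^+ e \in unitmx.
    by elim: e => [|e IHe]; rewrite ?unitmx1 // exprS unitmx_mul uM.
  move=> + M0; rewrite M0 -row_full_unit /row_full mxrank0 => /eqP n0.
  by rewrite /mxtrace big1 // => i; have := ltn_ord i; rewrite -[X in (_ < X)%N]n0.
move=> M0; rewrite -[X in \tr X](mulmx_base M) mxtrace_mulC.
apply: (IHn _ rM _ e.+1).
have E k : (row_base M *m col_base M) ^+ k.+1 = row_base M *m M ^+ k *m col_base M.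
  elim: k => [|k IHk]; first by rewrite expr1 mulmx1.
  have -> : (row_base M *m col_base M) ^+ k.+2 =
      (row_base M *m M ^+ k *m col_base M) *m (row_base M *m col_base M).
    by rewrite exprSr IHk.
  have -> : M ^+ k.+1 = M ^+ k *m M by rewrite exprSr.
  rewrite -[X in _ = _ *m (_ *m X) *m _](mulmx_base M).
  by rewrite !mulmxA.
by rewrite E M0 mulmx0 mul0mx.
Qed.

Lemma trig_mul (R : comNzRingType) n (A B : 'M[R]_n) :
  is_trig_mx A -> is_trig_mx B ->
  is_trig_mx (A *m B) /\ forall i, (A *m B) i i = A i i * B i i.
Proof.
move=> /is_trig_mxP tA /is_trig_mxP tB; split=> [|i].
  apply/is_trig_mxP=> i j ij; rewrite mxE big1 // => l _.
  have [il|li] := ltnP i l; first by rewrite tA ?mul0r.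
  by rewrite tB ?mulr0 // (leq_ltn_trans li).
rewrite mxE (bigD1 i) //= big1 ?addr0 // => l li.
have [il|] := ltnP i l; first by rewrite tA ?mul0r.
by rewrite leq_eqVlt => /predU1P[/val_inj E|li2]; [rewrite E eqxx in li | rewrite tB ?mulr0].
Qed.

(** The [r i] are the diagonal entries of a Schur triangular form of [A]. *)
Lemma mxtrace_horner n (A : 'M[algC]_n.+1) :
  exists r : 'I_n.+1 -> algC, char_poly A = \prod_i ('X - (r i)%:P) /\
    forall f, \tr (horner_mx A f) = \sum_i f.[r i].
Proof.
have [P /unitarymx_unit uP tT] := Schur A (ltn0Sn n).
set T := conjmx P A in tT.
have AT : A = invmx P *m T *m P.
  by rewrite /T conjumx // !mulmxA mulVmx // mul1mx -mulmxA mulVmx // mulmx1.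
exists (fun i => T i i); split.
  rewrite -(char_poly_trig tT) /char_poly /char_poly_mx.
  pose Q := map_mx polyC P; pose Q' := map_mx (@polyC algC) (invmx P).
  have Q'Q : Q' *m Q = 1%:M by rewrite -map_mxM mulVmx // map_mx1.
  have -> : 'X%:M - map_mx polyC A = Q' *m ('X%:M - map_mx polyC T) *m Q.
    rewrite AT !map_mxM mulmxBr mulmxBl; congr (_ - _).
    by rewrite mul_mx_scalar -scalemxAl Q'Q scalemx1.
  rewrite !det_mulmx mulrAC -det_mulmx Q'Q det1 mul1r //.
have key f : is_trig_mx (horner_mx T f) /\ forall i, (horner_mx T f) i i = f.[T i i].
  elim/poly_ind: f => [|f c [IH1 IH2]].
    by rewrite rmorph0; split=> [|i]; rewrite ?mx0_is_trig // mxE horner0.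
  rewrite rmorphD rmorphM /= horner_mx_X horner_mx_C.
  have [m1 m2] := trig_mul IH1 tT; split.
    apply/is_trig_mxP=> i j ij; rewrite mxE (is_trig_mxP m1) // mxE.
    by rewrite -val_eqE /= ltn_eqF // mulr0n addr0.
  by move=> i; rewrite mxE m2 IH2 [c%:M i i]mxE eqxx hornerMXaddC.
move=> f; have [_ kd] := key f.
have -> : horner_mx A f = invmx P *m horner_mx T f *m P.
  rewrite /T horner_mx_conj ?row_free_unit ?sub1mx ?stablemx_full ?row_full_unit //.
  by rewrite conjumx // !mulmxA mulVmx // mul1mx -mulmxA mulVmx // mulmx1.
rewrite -mulmxA mxtrace_mulC -mulmxA mulmxV // mulmx1.
by apply: eq_bigr => i _; rewrite kd.
Qed.

(** Some power of [M] is idempotent, and its rank equals its trace modulo p, that is 0. So this rank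
    is 0 or p. *)
Lemma unit_or_nilp p (M : 'M['F_p]_p) : prime p ->
  (forall e, (0 < e)%N -> \tr (M ^+ e) = 0) ->
  M \in unitmx \/ exists2 e, (0 < e)%N & M ^+ e = 0.
Proof.
move=> p_pr trM.
have [a [c [a0 c0 ac]]] : exists a c, [/\ (0 < a)%N, (0 < c)%N & M ^+ (a + c) = M ^+ a].
  pose f (i : 'I_#|{: 'M['F_p]_p}|.+1) := M ^+ i.+1.
  have /injectivePn[i [j ij fij]] : ~~ injectiveb f.
    apply/negP=> /injectiveP/leq_card; rewrite card_ord.
    by rewrite ltnn.
  wlog lt_ij : i j ij fij / (i < j)%N.
    move=> th; case: (ltngtP i j) => [|ji|/val_inj E]; first exact: th.
      by apply: (th j i) => //; rewrite eq_sym.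
    by rewrite E eqxx in ij.
  exists i.+1, (j - i)%N; split; rewrite ?subn_gt0 //.
  by rewrite addSn subnKC 1?ltnW.
have per m t : (a <= m)%N -> M ^+ (m + t * c) = M ^+ m.
  move=> am; elim: t => [|t IHt]; first by rewrite addn0.
  have -> : (m + t.+1 * c = (m - a + t * c) + (a + c))%N.
    by rewrite addnACA subnK // mulSn (addnC c).
  by rewrite exprD ac -exprD addnAC subnK.
(* The exponent is a multiple of the period [c] and at least the preperiod [a], so that squaring
   does not change this power. *)
pose E := M ^+ (a * c).
have ac0 : (0 < a * c)%N by rewrite muln_gt0 a0.
have EE : E *m E = E by rewrite -[LHS]exprD per // leq_pmulr.
have: (\rank E)%:R = 0 :> 'F_p by rewrite -mxtrace_idem // trM.
move/eqP; rewrite -(dvdn_pcharf (pchar_Fp p_pr)) => /dvdnP[t rE].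
have := rank_leq_row E; rewrite rE -[X in (_ <= X)%N]mul1n leq_pmul2r ?prime_gt0 //.
case: t rE => [|[|]//] rE _.
  by right; exists (a * c)%N => //; apply/eqP; rewrite -mxrank_eq0 rE.
left; rewrite -row_full_unit /row_full eqn_leq rank_leq_col /=.
rewrite mul1n in rE; rewrite -[X in (X <= _)%N]rE /E -(prednK ac0) exprSr.
exact: mxrankM_maxr.
Qed.

End Traces.

(** * Algebras of prime degree *)

Section PrimeAlgebra.

Local Open Scope ring_scope.

Variables (n m : nat) (I : finType) (i0 : I).
Variables (B : I -> 'M[int]_n.+1) (L : I -> 'M[int]_m.+1).
Variables (c : I -> I -> I -> int) (val : I -> nat).
Hypotheses (B1 : B i0 = 1%:M) (L1 : L i0 = 1%:M).
Hypothesis BM : forall i j, B i *m B j = \sum_l c i j l *: B l.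
Hypothesis LM : forall i j, L i *m L j = \sum_l c i j l *: L l.
Hypothesis Brow : forall i, B i *m const_mx 1 = (val i)%:R *: const_mx 1 :> 'cV_n.+1.
Hypothesis Lrow : forall i, L i *m const_mx 1 = (val i)%:R *: const_mx 1 :> 'cV_m.+1.
Hypothesis Btr : forall i, \tr (B i) = if i == i0 then n.+1%:R else 0.
Hypothesis Bind : forall i, exists a b, forall j, B j a b = (j == i)%:R.

(** * The algebra with basis [I] after extension of scalars to a field *)

Section Ring.

Variable F : fieldType.

Definition mxB i : 'M[F]_n.+1 := map_mx intr (B i).
Definition mxL i : 'M[F]_m.+1 := map_mx intr (L i).

(* [inA M N s]: some element of the algebra with basis [I] acts as [M] and [N]
   and has valency [s]. *)
Definition inA (M : 'M[F]_n.+1) (N : 'M[F]_m.+1) (s : F) :=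
  exists x : I -> F, [/\ M = \sum_i x i *: mxB i, N = \sum_i x i *: mxL i
                       & s = \sum_i x i * (val i)%:R].

Lemma mxBM i j : mxB i *m mxB j = \sum_l (c i j l)%:~R *: mxB l.
Proof.
rewrite /mxB -map_mxM BM map_mx_sum; apply: eq_bigr => l _.
by rewrite map_mxZ.
Qed.

Lemma mxLM i j : mxL i *m mxL j = \sum_l (c i j l)%:~R *: mxL l.
Proof.
rewrite /mxL -map_mxM LM map_mx_sum; apply: eq_bigr => l _.
by rewrite map_mxZ.
Qed.

Lemma inA_row M N s : inA M N s ->
  M *m const_mx 1 = s *: const_mx 1 :> 'cV_n.+1 /\
  N *m const_mx 1 = s *: const_mx 1 :> 'cV_m.+1.
Proof.
have E q : const_mx 1 = map_mx intr (const_mx 1) :> 'cV[F]_q.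
  by rewrite map_const_mx rmorph1.
case=> x [-> -> ->]; split; rewrite mulmx_suml scaler_suml; apply: eq_bigr => i _.
  by rewrite -scalemxAl -scalerA /mxB E -map_mxM Brow map_mxZ rmorph_nat.
by rewrite -scalemxAl -scalerA /mxL E -map_mxM Lrow map_mxZ rmorph_nat.
Qed.

Lemma inA_lin M N s M' N' s' a : inA M N s -> inA M' N' s' ->
  inA (a *: M + M') (a *: N + N') (a * s + s').
Proof.
move=> [x [-> -> ->]] [x' [-> -> ->]]; exists (fun i => a * x i + x' i); split.
- by rewrite scaler_sumr -big_split; apply: eq_bigr => i _; rewrite scalerDl scalerA.
- by rewrite scaler_sumr -big_split; apply: eq_bigr => i _; rewrite scalerDl scalerA.
- by rewrite mulr_sumr -big_split; apply: eq_bigr => i _; rewrite mulrDl mulrA.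
Qed.

Lemma inA_one : inA 1%:M 1%:M 1.
Proof.
have val0 : val i0 = 1%N.
  have := Brow i0; rewrite B1 mul1mx => /matrixP/(_ 0 0); rewrite !mxE mulr1.
  by move/eqP; rewrite eq_sym (pnatr_eq1 int) => /eqP.
exists (fun i => (i == i0)%:R); split; rewrite (bigD1 i0) //= big1 ?addr0 ?eqxx.
- by rewrite scale1r /mxB B1 map_mx1.
- by move=> i /negbTE ->; rewrite scale0r.
- by rewrite scale1r /mxL L1 map_mx1.
- by move=> i /negbTE ->; rewrite scale0r.
- by rewrite val0 mulr1.
- by move=> i /negbTE ->; rewrite mul0r.
Qed.

Lemma inA_scalar a : inA a%:M a%:M a.
Proof.
have := inA_lin (a - 1) inA_one inA_one.
by rewrite !scalemx1 -!raddfD /= mulr1 subrK.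
Qed.

Lemma inA_mul M N s M' N' s' : inA M N s -> inA M' N' s' ->
  inA (M *m M') (N *m N') (s * s').
Proof.
move=> H H'; have [Ms _] := inA_row H; have [Ms' _] := inA_row H'.
case: H H' => x [EM EN Es] [x' [EM' EN' Es']].
pose z l := \sum_i \sum_j x i * x' j * (c i j l)%:~R.
have Hz : inA (M *m M') (N *m N') (\sum_l z l * (val l)%:R).
  exists z; split=> //.
  - rewrite EM EM' mulmx_suml; under eq_bigr do rewrite mulmx_sumr.
    transitivity (\sum_i \sum_j \sum_l (x i * x' j * (c i j l)%:~R) *: mxB l).
      apply: eq_bigr => i _; apply: eq_bigr => j _.
      rewrite -scalemxAl -scalemxAr scalerA mxBM scaler_sumr.
      by apply: eq_bigr => l _; rewrite scalerA.
    under eq_bigr do rewrite exchange_big; rewrite exchange_big /=.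
    apply: eq_bigr => l _; rewrite scaler_suml; apply: eq_bigr => i _.
    by rewrite scaler_suml.
  - rewrite EN EN' mulmx_suml; under eq_bigr do rewrite mulmx_sumr.
    transitivity (\sum_i \sum_j \sum_l (x i * x' j * (c i j l)%:~R) *: mxL l).
      apply: eq_bigr => i _; apply: eq_bigr => j _.
      rewrite -scalemxAl -scalemxAr scalerA mxLM scaler_sumr.
      by apply: eq_bigr => l _; rewrite scalerA.
    under eq_bigr do rewrite exchange_big; rewrite exchange_big /=.
    apply: eq_bigr => l _; rewrite scaler_suml; apply: eq_bigr => i _.
    by rewrite scaler_suml.
(* The valency of a product is read off its action on the all-ones vector. *)
suff -> : s * s' = \sum_l z l * (val l)%:R by [].
have [] := inA_row Hz; rewrite -mulmxA Ms' -scalemxAr Ms scalerA => + _.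
by move/matrixP/(_ 0 0); rewrite !mxE !mulr1 mulrC.
Qed.

Lemma inA_exp M N s e : inA M N s -> inA (M ^+ e) (N ^+ e) (s ^+ e).
Proof.
move=> H; elim: e => [|e IHe]; first exact: inA_one.
by rewrite !exprS; apply: inA_mul.
Qed.

Lemma inA_horner M N s f : inA M N s -> inA (horner_mx M f) (horner_mx N f) f.[s].
Proof.
move=> H; elim/poly_ind: f => [|f a IHf].
  by rewrite !rmorph0 horner0; have := inA_scalar 0; rewrite !raddf0.
rewrite !rmorphD !rmorphM /= !horner_mx_X !horner_mx_C hornerMXaddC.
have := inA_lin 1 (inA_mul IHf H) (inA_scalar a).
by rewrite !scale1r mul1r.
Qed.

Lemma inA_tr M N s : (n.+1%:R = 0 :> F) -> inA M N s -> \tr M = 0.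
Proof.
move=> p0 [x [-> _ _]]; rewrite raddf_sum big1 // => i _ /=.
rewrite mxtraceZ; have -> : \tr (mxB i) = (\tr (B i))%:~R.
  by rewrite [in RHS]/mxtrace rmorph_sum; apply: eq_bigr => j _; rewrite mxE.
by rewrite Btr; case: eqP => _; rewrite ?rmorph0 ?rmorph_nat ?p0 mulr0.
Qed.

Lemma mxB_free (x : I -> F) : \sum_i x i *: mxB i = 0 -> forall i, x i = 0.
Proof.
move=> E i; have [a [b Bab]] := Bind i.
have := congr1 (fun A : 'M_n.+1 => A a b) E; rewrite summxE (bigD1 i) //= big1.
  by rewrite addr0 !mxE Bab eqxx mulr1.
by move=> j /negbTE ji; rewrite !mxE Bab ji mulr0.
Qed.

End Ring.

(** * Reduction modulo the prime degree *)

Hypothesis p_pr : prime n.+1.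

(** All powers of [M] have trace 0, so [unit_or_nilp] applies; the nonzero eigenvalue [s] at the
    all-ones vector excludes nilpotency. *)
Lemma inA_unit (M : 'M['F_n.+1]_n.+1) N s : inA M N s -> s != 0 -> M \in unitmx.
Proof.
move=> H s0; have p0 : n.+1%:R = 0 :> 'F_n.+1 by rewrite pchar_Fp_0.
case: (@unit_or_nilp n.+1 M) => // [e _|[e _ Me]].
  exact: inA_tr p0 (inA_exp e H).
have [] := inA_row (inA_exp e H); rewrite Me mul0mx => /matrixP/(_ 0 0) + _.
by rewrite !mxE mulr1 => /esym/eqP; rewrite expf_eq0 (negbTE s0) andbF.
Qed.

(** The all-ones vector lies in the kernel, so [M] is nilpotent. Since the [mxB i] are free, a
    vanishing power has zero coordinates, and the same power of [N] vanishes. *)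
Lemma inA_nilp (M : 'M['F_n.+1]_n.+1) N : inA M N 0 -> exists e, M ^+ e = 0 /\ N ^+ e = 0.
Proof.
move=> H; have p0 : n.+1%:R = 0 :> 'F_n.+1 by rewrite pchar_Fp_0.
case: (@unit_or_nilp n.+1 M) => // [e _||[e _ Me]].
- exact: inA_tr p0 (inA_exp e H).
- move=> uM; have [] := inA_row H; rewrite scale0r => M0 _.
  have /matrixP/(_ 0 0) : invmx M *m (M *m const_mx 1) = 0 :> 'cV_n.+1.
    by rewrite M0 mulmx0.
  by rewrite mulmxA mulVmx // mul1mx !mxE => /eqP; rewrite oner_eq0.
exists e; split=> //; have [x [Ex -> _]] := inA_exp e H.
have x0 := mxB_free (etrans (esym Ex) Me).
by rewrite big1 // => i _; rewrite x0 scale0r.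
Qed.

(** N - s has valency 0, hence is nilpotent and of trace 0. *)
Lemma inA_trL (M : 'M['F_n.+1]_n.+1) N s : inA M N s -> \tr N = m.+1%:R * s.
Proof.
move=> H; have := inA_lin 1 H (inA_scalar (- s)).
rewrite !scale1r mul1r subrr => /inA_nilp[e [_ /mxtrace_nilp/eqP]].
by rewrite raddfD /= mxtrace_scalar mulNrn subr_eq0 mulr_natl => /eqP.
Qed.


(** * Equality of the nontrivial valencies *)

Variables (t : I -> I) (k : nat).
Hypothesis tK : involutive t.
Hypothesis BT : forall i j,
  \tr (B i *m B j) = if j == t i then (n.+1 * val i)%N%:R else 0.
Hypothesis val_gt0 : forall i, (0 < val i)%N.
Hypothesis val_sum : (\sum_i val i = n.+1)%N.
Hypothesis LtrT : forall i, \tr (L (t i)) = \tr (L i).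
Hypothesis Ltr_sum : \sum_i \tr (L i) = n.+1%:R.
Hypothesis k_def : (k * m = n)%N.
Hypothesis cardI : #|I| = m.+1.

(* [phi] measures the failure of k tr L = (k - 1) val + tr B.  [Y] represents
   it for the trace form: tr (M Y) = kap * phi M, the factor [kap] clearing the
   denominators [val i]. *)
Let phi i : int := k%:Z * \tr (L i) - (k%:Z - 1) * (val i)%:Z - \tr (B i).
Let psi i : int := (phi i %/ n.+1%:Z)%Z.
Let w i : nat := (\prod_(j | j != i) val j)%N.
Let kap : nat := (\prod_j val j)%N.
Let z i : int := (w i)%:Z * psi (t i).
Let Y : 'M[int]_n.+1 := \sum_i z i *: B i.
Let Z : 'M[int]_m.+1 := \sum_i z i *: L i.

Lemma inA_int (F : fieldType) (u : I -> int) :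
  inA (map_mx intr (\sum_i u i *: B i)) (map_mx intr (\sum_i u i *: L i))
    ((\sum_i u i * (val i)%:Z)%:~R : F).
Proof.
exists (fun i => (u i)%:~R); split.
- by rewrite map_mx_sum; apply: eq_bigr => i _; rewrite map_mxZ.
- by rewrite map_mx_sum; apply: eq_bigr => i _; rewrite map_mxZ.
- by rewrite rmorph_sum; apply: eq_bigr => i _; rewrite rmorphM.
Qed.

Lemma valT i : val (t i) = val i.
Proof.
have := BT i (t i); rewrite mxtrace_mulC BT tK !eqxx.
by move/eqP; rewrite (eqr_nat int) eqn_pmul2l // => /eqP.
Qed.

Lemma tr_map (F : fieldType) q (A : 'M[int]_q) : \tr (map_mx intr A) = (\tr A)%:~R :> F.
Proof. by rewrite /mxtrace rmorph_sum; apply: eq_bigr => i _; rewrite mxE. Qed.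

(** The division in [psi] is exact: modulo the prime, tr B = 0 and tr L = (m + 1) val, so [phi]
    becomes (k m + 1) val = (n + 1) val = 0. *)
Lemma phi_psi i : phi i = psi i * n.+1%:Z.
Proof.
apply/esym/divzK; have p0 : n.+1%:R = 0 :> 'F_n.+1 by rewrite pchar_Fp_0.
have H := @inA_int 'F_n.+1 (fun j => (j == i)%:R).
have E q (A : I -> 'M[int]_q) : \sum_j (j == i)%:R *: A j = A i.
  rewrite (bigD1 i) //= big1 ?addr0 ?eqxx ?scale1r // => j /negbTE ->.
  by rewrite scale0r.
have Es : \sum_j (j == i)%:R * (val j)%:Z = (val i)%:Z.
  rewrite (bigD1 i) //= big1 ?addr0 ?eqxx ?mul1r // => j /negbTE ->.
  by rewrite mul0r.
rewrite !E Es in H.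
have := inA_trL H; have := inA_tr p0 H; rewrite !tr_map => B0 LE.
have : (phi i)%:~R = 0 :> 'F_n.+1.
  rewrite /phi !rmorphB !rmorphM /= B0 LE rmorphB /= -!pmulrn.
  have -> : m.+1%:R = m%:R + 1 :> 'F_n.+1 by rewrite -natr1.
  have p1 : k%:R * m%:R + 1 = 0 :> 'F_n.+1 by rewrite -natrM k_def natr1.
  set v := (val i)%:R; transitivity ((k%:R * m%:R + 1) * v); first by ring.
  by rewrite p1 mul0r.
move/eqP; rewrite -(dvdz_pcharf (pchar_Fp p_pr)) //.
Qed.

Lemma phi_sum : \sum_i phi i = 0.
Proof.
rewrite /phi !sumrB -!mulr_sumr Ltr_sum.
have -> : \sum_i (val i)%:Z = n.+1%:Z.
  by rewrite -val_sum -[RHS]natz natr_sum; apply: eq_bigr => i _; rewrite natz.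
have -> : \sum_i \tr (B i) = n.+1%:R.
  by under eq_bigr do rewrite Btr; rewrite -big_mkcond big_pred1_eq.
by rewrite natz; ring.
Qed.

Lemma psi_sum : \sum_i psi i = 0.
Proof.
have := phi_sum; under eq_bigr do rewrite phi_psi; rewrite -mulr_suml => /eqP.
by rewrite mulf_eq0 orbF => /eqP.
Qed.

Lemma psiT i : psi (t i) = psi i.
Proof.
rewrite /psi /phi LtrT valT; congr (_ %/ _)%Z; congr (_ - _).
have t0 : t i0 = i0.
  have := BT i0 i0; rewrite B1 mulmx1 mxtrace1; case: eqP => // _ /eqP.
  by rewrite pnatr_eq0.
by rewrite !Btr -{1}t0 (inj_eq (can_inj tK)).
Qed.

Lemma w_val i : (w i * val i = kap)%N.
Proof. by rewrite /kap (bigD1 i) //= mulnC. Qed.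

(** This is the valency of [Y]; its vanishing makes the all-ones vectors kernel vectors of [Y] and
    [Z]. *)
Lemma z_sum : \sum_i z i * (val i)%:Z = 0.
Proof.
transitivity (kap%:Z * \sum_i psi i); last by rewrite psi_sum mulr0.
rewrite mulr_sumr; apply: eq_bigr => i _.
by rewrite /z psiT mulrAC -PoszM w_val.
Qed.

Lemma inAY (F : fieldType) : inA (map_mx intr Y) (map_mx intr Z) (0 : F).
Proof. by have := @inA_int F z; rewrite z_sum. Qed.

Lemma trBY j : \tr (B j *m Y) = z (t j) * (n.+1 * val j)%N%:Z.
Proof.
rewrite /Y mulmx_sumr [LHS]raddf_sum /=.
rewrite (bigD1 (t j)) //= big1 ?addr0; last first.
  by move=> l /negbTE lj; rewrite -scalemxAr mxtraceZ BT lj mulr0.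
by rewrite -scalemxAr mxtraceZ BT eqxx natz.
Qed.

Lemma trMY (F : fieldType) M N s : @inA F M N s ->
  \tr (M *m map_mx intr Y) = kap%:R * (k%:R * \tr N - (k%:R - 1) * s - \tr M).
Proof.
move=> [x [-> -> ->]].
have trB i : \tr (mxB F i) = (\tr (B i))%:~R by rewrite tr_map.
have trL i : \tr (mxL F i) = (\tr (L i))%:~R by rewrite tr_map.
transitivity (\sum_i x i * (kap%:R * (phi i)%:~R)).
  rewrite mulmx_suml raddf_sum; apply: eq_bigr => i _ /=.
  rewrite -scalemxAl mxtraceZ; congr (_ * _).
  have -> : mxB F i = map_mx intr (B i) by [].
  rewrite -map_mxM tr_map.
  rewrite trBY /z tK phi_psi -(w_val (t i)) valT.
  rewrite natrM !PoszM !rmorphM /= -!pmulrn; ring.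
have trS q (A : I -> 'M[F]_q) : \tr (\sum_i x i *: A i) = \sum_i x i * \tr (A i).
  by rewrite [LHS]raddf_sum; apply: eq_bigr => i _; rewrite /= mxtraceZ.
rewrite !trS !mulr_sumr -!sumrB mulr_sumr; apply: eq_bigr => i _.
by rewrite trB trL /phi !rmorphB !rmorphM /= rmorphB /= -!pmulrn; ring.
Qed.


(** Every factor lies strictly between 0 and the prime, because the positive valencies sum to [n.+1]
    and there are at least two of them. *)
Lemma kap_coprime : ~~ (n.+1 %| kap)%N.
Proof.
rewrite /kap; elim/big_ind: _ => [|x y px py|i _].
- by rewrite Euclid_dvd1.
- by rewrite Euclid_dvdM // negb_or px.
have vi : (val i < n.+1)%N.
  have [->|ii0] := eqVneq i i0.
    have /matrixP/(_ 0 0) := Brow i0; rewrite B1 mul1mx !mxE mulr1 => /esym/eqP.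
    by rewrite (pnatr_eq1 int) => /eqP ->; apply: prime_gt1.
  rewrite -val_sum (bigD1 i) //= (bigD1 i0) 1?eq_sym //=.
  by have := val_gt0 i0; lia.
by apply/negP=> /dvdn_leq -/(_ (val_gt0 i)); rewrite leqNgt vi.
Qed.

(** The all-ones vector gives the eigenvalue 0, which occupies at least one of the q + 1 places. *)
Lemma col_root0 q (A : 'M[algC]_q.+1) (r : 'I_q.+1 -> algC) (y : algC) :
  A *m const_mx 1 = 0 :> 'cV_q.+1 -> char_poly A = \prod_i ('X - (r i)%:P) ->
  y != 0 -> (#|[pred i | r i == y]| <= q)%N.
Proof.
move=> A1 chA y0; have : (char_poly A).[0] = 0.
  rewrite horner_coef0 char_poly_det; suff -> : \det A = 0 by rewrite mulr0.
  apply/eqP; apply: contraT => dA; have uA : A \in unitmx by rewrite unitmxE unitfE.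
  have /matrixP/(_ 0 0) : invmx A *m (A *m const_mx 1) = 0 :> 'cV_q.+1.
    by rewrite A1 mulmx0.
  by rewrite mulmxA mulVmx // mul1mx !mxE => /eqP; rewrite oner_eq0.
rewrite chA horner_prod => /eqP/prodf_eq0[i _]; rewrite hornerXsubC sub0r oppr_eq0 => ri.
rewrite -ltnS -[X in (_ < X)%N]card_ord; apply: proper_card.
apply/properP; split; first by apply/subsetP.
by exists i; rewrite // inE (eqP ri) eq_sym.
Qed.

(* For an eigenvalue y <> 0 of [Y], testing [trMY] on a polynomial vanishing at
   all other eigenvalues gives mu y = kap (k de - mu), where mu and de are the
   multiplicities of y in [Y] and [Z].  So y is a rational integer, divisible by
   the prime by [inA_unit]; as both k de and mu are at most n, they are equal,
   and y = 0. *)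
Lemma eigenvalues0 (r : 'I_n.+1 -> algC) :
  char_poly (map_mx intr Y) = \prod_i ('X - (r i)%:P) -> forall i, r i = 0.
Proof.
have HY := inAY algC.
have [r1 [chY trY]] := mxtrace_horner (map_mx intr Y : 'M[algC]_n.+1).
have [r2 [chZ trZ]] := mxtrace_horner (map_mx intr Z : 'M[algC]_m.+1).
move=> chY' i; apply/eqP; apply: contraT => y0; set y := r i in y0.
have rooty : root (char_poly (map_mx intr Y)) y.
  by rewrite chY' /root horner_prod (bigD1 i) //= hornerXsubC subrr mul0r.
pose mu := #|[pred j | r1 j == y]|; pose de := #|[pred j | r2 j == y]|.
have mu_gt0 : (0 < mu)%N.
  move: rooty; rewrite chY /root horner_prod => /prodf_eq0[j _].
  rewrite hornerXsubC subr_eq0 => yj; apply/card_gt0P; exists j.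
  by rewrite inE eq_sym.
have [Y0 Z0] := inA_row HY; rewrite !scale0r in Y0 Z0.
have mu_n : (mu <= n)%N := col_root0 Y0 chY y0.
have de_m : (de <= m)%N := col_root0 Z0 chZ y0.
have muE : mu%:R * y = kap%:R * (k%:R * de%:R - mu%:R).
  (* The roots of [f] are to be all eigenvalues of [Y] and [Z] other than [y]. Including 0 kills the
     valency [f.[0]] of f(Y) in [trMY]. *)
  pose S := [seq x <- 0 :: codom r1 ++ codom r2 | x != y].
  pose f : {poly algC} := \prod_(x <- S) ('X - x%:P).
  have fy : f.[y] != 0.
    rewrite /f horner_prod prodf_seq_neq0; apply/allP=> x; rewrite mem_filter => /andP[xy _].
    by rewrite hornerXsubC subr_eq0 eq_sym.
  have f0 x : x \in 0 :: codom r1 ++ codom r2 -> x != y -> f.[x] = 0.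
    move=> xS xy; apply/eqP; rewrite -[_ == 0]/(root f x) root_prod_XsubC.
    by rewrite mem_filter xy.
  have sumf q (rr : 'I_q -> algC) (g : {poly algC}) :
      (forall j, rr j != y -> g.[rr j] = 0) ->
      \sum_j g.[rr j] = (#|[pred j | rr j == y]|)%:R * g.[y].
    move=> g0; rewrite (bigID [pred j | rr j == y]) /= [X in _ + X]big1 // addr0.
    under eq_bigr => j /eqP -> do []; rewrite sumr_const mulr_natl //.
  have := trMY (inA_horner f HY).
  have -> : horner_mx (map_mx intr Y) f *m map_mx intr Y
          = horner_mx (map_mx intr Y) (f * 'X).
    by rewrite rmorphM /= horner_mx_X.
  rewrite trY trY trZ (f0 0) ?mulr0 ?subr0 ?inE ?eqxx //; last by rewrite eq_sym.
  rewrite !sumf.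
  - rewrite hornerMX -/mu -/de => E; apply: (mulIf fy).
    by rewrite -mulrA (mulrC y) E; ring.
  - by move=> j; apply: f0; rewrite inE mem_cat codom_f orbT.
  - by move=> j; apply: f0; rewrite inE mem_cat codom_f !orbT.
  - by move=> j jy; rewrite hornerMX f0 ?mul0r // inE mem_cat codom_f orbT.
have [x yx] : exists x : int, y = x%:~R.
  suff /Num.Theory.intrP : y \is a Num.int by [].
  apply: Cint_rat_Aint; last first.
    apply: root_monic_Aint rooty (char_poly_monic _) _.
    rewrite -map_char_poly; apply/polyOverP=> j; rewrite coef_map /=.
    exact: intr_int.
  have -> : y = kap%:R * (k%:R * de%:R - mu%:R) / mu%:R.
    by rewrite -muE mulrC mulKf // pnatr_eq0 -lt0n.
  by rewrite !(rpredM, rpredB, rpred_nat, rpredV).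
(* Modulo the prime, [x] is still an eigenvalue of [Y], whereas Y - x has valency -x and would be
   invertible if x were nonzero. *)
have px : (n.+1%:Z %| x)%Z.
  rewrite (dvdz_pcharf (pchar_Fp p_pr)).
  apply: contraT => x0.
  have : root (char_poly (map_mx intr Y : 'M['F_n.+1]_n.+1)) x%:~R.
    rewrite -map_char_poly /root horner_map /=.
    move: rooty; rewrite yx -map_char_poly /root horner_map /= intr_eq0 => /eqP ->.
    by rewrite rmorph0.
  rewrite -eigenvalue_root_char /eigenvalue /eigenspace kermx_eq0 row_free_unit.
  have := inA_lin 1 (inAY 'F_n.+1) (inA_scalar (- x%:~R)).
  rewrite !scale1r mulr0 add0r raddfN /= => /inA_unit ->; rewrite ?oppr_eq0 //.
have : (mu%:Z * x) = kap%:Z * (k%:Z * de%:Z - mu%:Z).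
  apply: (@intr_inj algC); rewrite !rmorphM /= rmorphB rmorphM /= -!pmulrn -yx.
  exact: muE.
move=> E; have : (n.+1%:Z %| k%:Z * de%:Z - mu%:Z)%Z.
  have : (n.+1%:Z %| kap%:Z * (k%:Z * de%:Z - mu%:Z))%Z by rewrite -E dvdz_mull.
  by rewrite Gauss_dvdzr // coprimezE !absz_nat prime_coprime // kap_coprime.
have kde : (k * de <= n)%N by rewrite -k_def leq_mul2l de_m orbT.
move=> /dvdzP[g gE].
have g0 : g = 0 by move: kde mu_n mu_gt0 gE; rewrite -PoszM; nia.
move: E; rewrite gE g0 mul0r mulr0 => /eqP; rewrite mulf_eq0 => /orP[/eqP|/eqP x0].
  by move: mu_gt0; case: (mu).
by rewrite yx x0 eqxx in y0.
Qed.

(** All eigenvalues of [Y] vanish, so tr (Y Y) = 0; but this trace is a sum of the squares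
    [psi i ^+ 2] with positive weights. *)
Lemma psi_eq0 i : psi i = 0.
Proof.
have [r [chY trY]] := mxtrace_horner (map_mx intr Y : 'M[algC]_n.+1).
have r0 := eigenvalues0 chY.
have : \tr (Y *m Y) = 0.
  apply: (@intr_inj algC); rewrite -tr_map map_mxM rmorph0.
  have := trY 'X^2; rewrite rmorphXn /= horner_mx_X => ->.
  by rewrite big1 // => j _; rewrite hornerXn r0 expr0n.
have -> : \tr (Y *m Y) = \sum_i kap%:Z * n.+1%:Z * ((w i)%:Z * psi i ^+ 2).
  rewrite {1}/Y mulmx_suml [LHS]raddf_sum; apply: eq_bigr => j _ /=.
  rewrite -scalemxAl mxtraceZ.
  by rewrite trBY /z tK psiT -(w_val (t j)) valT !PoszM; ring.
move/eqP; rewrite psumr_eq0 => [/allP/(_ i (mem_index_enum _))/=|j _]; last first.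
  by apply: mulr_ge0 => //; apply: mulr_ge0 => //; apply: sqr_ge0.
have w0 j : (0 < w j)%N by rewrite /w prodn_cond_gt0.
have kap0 : (0 < kap)%N by rewrite prodn_gt0.
have pos x : (0 < x)%N -> x%:Z != 0 by case: x.
rewrite mulf_eq0 mulf_eq0 (negbTE (pos _ kap0)) /= mulf_eq0 (negbTE (pos _ (w0 i))).
by rewrite sqrf_eq0 => /eqP.
Qed.

(** Now k tr L = (k - 1) val off [i0], so k, being prime to k - 1, divides each of these [m]
    valencies. They sum to n = k m, hence all equal k. *)
Lemma prime_valencies i : i != i0 -> val i = k /\ \tr (L i) = k%:Z - 1.
Proof.
have E j : j != i0 -> k%:Z * \tr (L j) = (k%:Z - 1) * (val j)%:Z.
  move=> /negbTE j0; have := phi_psi j; rewrite psi_eq0 mul0r /phi Btr j0 subr0.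
  by move/eqP; rewrite subr_eq0 => /eqP.
have n0 : (0 < n)%N by have := prime_gt1 p_pr.
have k0 : (0 < k)%N by rewrite lt0n; apply: contraTneq n0 => k0; rewrite -k_def k0.
have val_ge j : j != i0 -> (k <= val j)%N.
  move=> /E Ej; apply: dvdn_leq => //.
  have : (k%:Z %| (k%:Z - 1) * (val j)%:Z)%Z by rewrite -Ej dvdz_mulr.
  rewrite Gauss_dvdzr //.
  have -> : k%:Z - 1 = k.-1%:Z by lia.
  by rewrite coprimezE !absz_nat -{1}(prednK k0) coprimeSn.
have val0 : val i0 = 1%N.
  have := Brow i0; rewrite B1 mul1mx => /matrixP/(_ 0 0); rewrite !mxE mulr1.
  by move/eqP; rewrite eq_sym (pnatr_eq1 int) => /eqP.
have valE j : j != i0 -> val j = k.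
  move=> j0; apply/eqP; rewrite eqn_leq val_ge // andbT leqNgt; apply/negP => lt_j.
  have : (\sum_(l | l != i0) k < \sum_(l | l != i0) val l)%N.
    rewrite (bigD1 j) //= [X in (_ < X)%N](bigD1 j) //= -addSn leq_add //.
    by apply: leq_sum => l /andP[l0 _]; apply: val_ge.
  have := val_sum; rewrite (bigD1 i0) //= val0 sum_nat_const cardC1 cardI /=.
  by rewrite mulnC k_def; lia.
move=> ii0; split; first exact: valE.
have := E i ii0; rewrite valE // mulrC => /mulIf; apply.
by rewrite eqz_nat -lt0n.
Qed.

End PrimeAlgebra.

(** * Arithmetic of the valencies *)

Section IntersectionNumbers.

Variables (I J K : finType) (k d : nat) (r : I -> nat) (h c : I -> J -> nat).
Variable (g : I -> I -> K -> nat).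
(* [I] indexes the relations A_R between X and Y, [J] and [K] the nondiagonal
   relations B_j on X and C_l on Y.  [c R j] is the coefficient of B_j in
   A_R A_R^T, [h R j] that of A_R in B_j A_R, and [g R S l] that of C_l in
   A_R^T A_S. *)
Hypothesis k_gt0 : 0 < k.
Hypothesis d_gt1 : 1 < d.
Hypothesis cardI : #|I| = d.+1.
Hypothesis r_gt0 : forall R, 0 < r R.
Hypothesis r_sum : \sum_R r R = (d * k).+1.
Hypothesis hc : forall R j, r R * h R j = k * c R j.
Hypothesis c_sum : forall R, k * \sum_j c R j = r R * (r R).-1.
Hypothesis h_sum : forall j, \sum_R h R j = k.-1.
Hypothesis g_sum : forall R S, R != S -> k * \sum_l g R S l = r R * r S.
Hypothesis g_dvdl : forall R S l, R != S -> r R %| k * g R S l.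
Hypothesis g_dvdr : forall R S l, R != S -> r S %| k * g R S l.
Hypothesis g_sqr : forall R S, R != S ->
  r R * r S + k * \sum_j c R j * c S j = k * \sum_l g R S l ^ 2.

Lemma dvdk_pred R : k %| r R * (r R).-1.
Proof. by rewrite -c_sum dvdn_mulr. Qed.

Lemma dvdk_mul R S : R != S -> k %| r R * r S.
Proof. by move/g_sum <-; rewrite dvdn_mulr. Qed.

Lemma card_other (R0 S : I) : S != R0 -> #|[pred T | (T != R0) && (T != S)]| = d.-1.
Proof.
move=> SR0; have := cardC1 R0; rewrite cardI /= (cardD1 S) !inE SR0 /= add1n => E.
by rewrite -[in RHS]E /=; apply: eq_card => T; rewrite !inE andbC.
Qed.

Lemma thin_if_large R0 : (forall S, S != R0 -> k <= r S) -> r R0 = 1.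
Proof.
move=> kr; have := r_sum; rewrite (bigD1 R0) //=.
have : \sum_(S | S != R0) k <= \sum_(S | S != R0) r S by apply: leq_sum.
by rewrite sum_nat_const cardC1 cardI /=; have := r_gt0 R0; lia.
Qed.

(** If all valencies equal k, then (d + 1) k = d k + 1 and k = 1. Otherwise exactly one differs from
    k, since two proper divisors of k contribute at most k together and keep the total below d k +
    1; [thin_if_large] applies to that one. *)
Lemma thin_if_dvd : (forall R, r R %| k) -> exists R, r R = 1.
Proof.
move=> rk; have [/existsP[R0 ne]|/existsPn all_k] := boolP [exists R, r R != k].
  exists R0; apply: thin_if_large => S SR0; rewrite leqNgt; apply/negP=> ltS.
  have half R : r R != k -> r R + r R <= k.
    move=> neR; have /dvdnP[t kt] := rk R.
    have : t != 0 /\ t != 1 by split; apply/eqP=> t0; move: kt neR k_gt0; rewrite t0; lia.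
    by case: t kt => [|[|t]] kt [] // _ _; rewrite kt !mulSn addnA leq_addr.
  have := r_sum; rewrite (bigD1 R0) //= (bigD1 S) //=.
  have : \sum_(T | (T != R0) && (T != S)) r T <= \sum_(T | (T != R0) && (T != S)) k.
    by apply: leq_sum => T _; apply: dvdn_leq.
  rewrite sum_nat_const.
  rewrite card_other //.
  by have := half _ ne; have := half S; rewrite ltn_eqF // => /(_ isT); nia.
have := r_sum; rewrite (eq_bigr (fun=> k)).
  rewrite sum_nat_const cardT -cardE cardI => E.
  have /card_gt0P[R _] : 0 < #|I| by rewrite cardI.
  by exists R; have := all_k R; rewrite negbK => /eqP ->; lia.
by move=> R _; have := all_k R; rewrite negbK => /eqP.
Qed.

(** As q divides k, it cannot divide the sum d k + 1 of all valencies, so it misses some [r R0].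
    This factor then cancels from [dvdk_pred] and [dvdk_mul]. *)
Lemma prime_part q t : prime q -> 0 < t -> q ^ t %| k ->
  exists2 R0, q ^ t %| (r R0).-1 & forall S, S != R0 -> q ^ t %| r S.
Proof.
move=> q_pr t0 qk; have q_k : q %| k by apply: dvdn_trans qk; rewrite dvdn_exp.
have [/existsP[R0 qR0]|/existsPn all_q] := boolP [exists R, ~~ (q %| r R)].
  exists R0.
    rewrite -(@Gauss_dvdr _ (r R0)) ?(dvdn_trans qk) ?dvdk_pred //.
    by rewrite coprimeXl // prime_coprime.
  move=> S SR0; rewrite -(@Gauss_dvdr _ (r R0)) ?(dvdn_trans qk) ?dvdk_mul 1?eq_sym //.
  by rewrite coprimeXl // prime_coprime.
have : q %| (d * k).+1 by rewrite -r_sum dvdn_sum // => R _; have := all_q R; rewrite negbK.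
rewrite -addn1 dvdn_addr ?dvdn_mull // dvdn1 => /eqP q1.
by rewrite q1 in q_pr.
Qed.

Lemma thin_prime_power : prime_power k -> exists R, r R = 1.
Proof.
case=> q [t [q_pr [t0 kE]]]; case: (@prime_part q t) => //; first by rewrite kE.
move=> R0 _ H; exists R0; apply: thin_if_large => S /H; rewrite -kE.
exact: dvdn_leq.
Qed.

Definition exceptional := [set R | ~~ (k %| r R)].

(** Each exceptional [R] is assigned a prime divisor of k that divides r - 1; by [dvdk_mul] no prime
    divisor of k can miss two valencies, so the assignment is injective. *)
Lemma card_exceptional : #|exceptional| <= size (primes k).
Proof.
pose f R := pdiv (gcdn k (r R).-1).
have fP R : R \in exceptional -> [/\ prime (f R), f R %| k & ~~ (f R %| r R)].
  rewrite inE => kR; have g1 : 1 < gcdn k (r R).-1.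
    rewrite ltn_neqAle gcdn_gt0 k_gt0 /= andbT eq_sym; apply: contra kR => co.
    by rewrite -(@Gauss_dvdl _ _ (r R).-1) ?dvdk_pred.
  have := pdiv_prime g1; have := pdiv_dvd (gcdn k (r R).-1); rewrite -/(f R).
  rewrite dvdn_gcd => /andP[-> fr] fp; split=> //; apply/negP=> fR.
  have : f R %| 1 by rewrite -(@dvdn_addr (r R).-1) // addn1 prednK.
  by rewrite dvdn1 => /eqP E; rewrite E in fp.
rewrite cardE -(size_map f); apply: uniq_leq_size.
  rewrite map_inj_in_uniq ?enum_uniq // => R S; rewrite !mem_enum => HR HS E.
  have [fp fk fR] := fP R HR; have [_ _ fS] := fP S HS.
  apply/eqP; apply: contraT => /dvdk_mul/(dvdn_trans fk).
  by rewrite Euclid_dvdM // (negbTE fR) E (negbTE fS).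
move=> q /mapP[R]; rewrite mem_enum => /fP[fp fk _] ->.
by rewrite mem_primes fp k_gt0.
Qed.

(** With e the number of prime divisors of k, at least d - e of the other valencies are positive
    multiples of k, and the total is d k + 1. *)
Lemma r_bound R : r R <= (size (primes k) * k).+1.
Proof.
have := r_sum; rewrite (bigD1 R) //=.
pose A := [set S | (S != R) && (k %| r S)].
have : #|A| * k <= \sum_(S | S != R) r S.
  rewrite -sum_nat_const [X in _ <= X](bigID (mem A)) /= -[X in X <= _]addn0 leq_add //.
  rewrite [X in _ <= X](eq_bigl (mem A)); last by move=> S; rewrite !inE; case: eqP.
  by apply: leq_sum => S; rewrite inE => /andP[_ /dvdn_leq ->].
have : d <= #|A| + #|exceptional|.
  have -> : d = #|[set~ R]| by rewrite cardsC1 cardI.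
  apply: leq_trans (leq_card_setU A exceptional); apply: subset_leq_card.
  by apply/subsetP=> S; rewrite !inE => ->; case: (k %| r S).
by have := card_exceptional; nia.
Qed.

(* When the supports of [c R] and [c S] are disjoint, [g_sqr] forces [g R S] to
   be 0/1-valued, whence [r R] divides [k]. *)
Lemma dvd_if_many R : (r R).-1 * k.-1 < d -> r R %| k.
Proof.
move=> many.
pose D := [set j | c R j != 0]; pose C j := [set S | c S j != 0].
have h_pos S j : c S j != 0 -> 0 < h S j.
  by move=> c0; have := hc S j; have := r_gt0 S; move: c0 k_gt0; nia.
have cardD : #|D| <= (r R).-1.
  have : \sum_j h R j = (r R).-1.
    have := c_sum R; rewrite big_distrr /=.
    under eq_bigr do rewrite -hc.
    by rewrite -big_distrr /= => /eqP; rewrite eqn_pmul2l // => /eqP.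
  move=> <-; rewrite -sum1_card [X in _ <= X](bigID (mem D)) /= -[X in X <= _]addn0 leq_add //.
  by apply: leq_sum => j; rewrite inE => /h_pos.
have cardC j : #|C j| <= k.-1.
  rewrite -(h_sum j) -sum1_card [X in _ <= X](bigID (mem (C j))) /= -[X in X <= _]addn0 leq_add //.
  by apply: leq_sum => S; rewrite inE => /h_pos.
(* The support [D] of [c R] has at most r - 1 elements, each in the support of at most k - 1 of the
   [c S], so the hypothesis leaves an [S] sharing no element with [R]. *)
have [S] : exists S, S \notin R |: \bigcup_(j in D) C j.
  apply/existsP; rewrite -negb_forall; apply/negP=> /forallP full.
  have : #|I| <= 1 + #|D| * k.-1.
    apply: leq_trans (_ : #|R |: \bigcup_(j in D) C j| <= _).
      by apply/subset_leq_card/subsetP=> S _; apply: full.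
    apply: leq_trans (leq_card_setU _ _) _; rewrite cards1 leq_add2l.
    apply: leq_trans (_ : \sum_(j in D) #|C j| <= _).
      elim/big_ind2: _ => [|A x B y Ax By|//]; first by rewrite cards0.
      exact: leq_trans (leq_card_setU _ _) (leq_add Ax By).
    by rewrite -sum_nat_const; apply: leq_sum => j _; apply: cardC.
  by rewrite cardI; move: cardD many; nia.
rewrite in_setU1 negb_or eq_sym => /andP[RS /bigcupP nS].
have disj : \sum_j c R j * c S j = 0.
  apply: big1 => j _; have [->//|cR] := eqVneq (c R j) 0.
  have [->|cS] := eqVneq (c S j) 0; first by rewrite muln0.
  by case: nS; exists j; rewrite inE.
have := g_sqr RS; rewrite disj muln0 addn0 -(g_sum RS) => /eqP.
rewrite eqn_pmul2l // eq_sym => /eqP gg.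
have [l gl] : exists l, g R S l != 0.
  apply/existsP; apply: contraT; rewrite negb_exists => /forallP g0.
  have := g_sum RS; rewrite big1 ?muln0; first by have := r_gt0 R; have := r_gt0 S; nia.
  by move=> l _; apply/eqP; have := g0 l; rewrite negbK.
have g1 : g R S l = 1.
  apply/eqP; rewrite eqn_leq lt0n gl andbT leqNgt; apply/negP=> gt1.
  have : \sum_l g R S l < \sum_l g R S l ^ 2.
    rewrite (bigD1 l) //= [X in _ < X](bigD1 l) //= -addSn leq_add //.
      by rewrite -mulnn; nia.
    by apply: leq_sum => i _; rewrite -mulnn; nia.
  by rewrite gg ltnn.
by have := g_dvdl l RS; rewrite g1 muln1.
Qed.

Lemma thin_many : k * k * (size (primes k)) <= d -> 1 < k -> exists R, r R = 1.
Proof.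
move=> dk k1; apply: thin_if_dvd => R; apply: dvd_if_many.
have e0 : 0 < size (primes k) by rewrite -has_predT; apply/hasP; exists (pdiv k) => //; rewrite mem_primes pdiv_prime // k_gt0 pdiv_dvd.
have := r_bound R; move: (size _) e0 dk => e e0 dk rb.
have : (r R).-1 <= e * k by lia.
move=> rb'; have : (r R).-1 * k.-1 <= e * k * k.-1 by rewrite leq_mul2r rb' orbT.
by nia.
Qed.


(** Cancelling [a] in [hc] leaves u h = b c with [u] prime to [b], so u divides c. *)
Lemma c_part R a b u j : r R = a * u -> k = a * b -> coprime u b ->
  c R j = u * (c R j %/ u) /\ h R j = b * (c R j %/ u).
Proof.
move=> rE kE co; have ru := r_gt0 R; rewrite rE muln_gt0 in ru; case/andP: ru => a0 u0.
have := hc R j; rewrite rE kE -!mulnA => /eqP; rewrite eqn_pmul2l // => /eqP E.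
have uc : u %| c R j by rewrite -(@Gauss_dvdr _ b) // -E dvdn_mulr.
have cE : c R j = u * (c R j %/ u) by rewrite mulnC divnK.
by split=> //; apply/eqP; rewrite -(eqn_pmul2l u0) E {1}cE mulnCA.
Qed.

Lemma g_part R S a b u l : R != S -> r R = a * u -> k = a * b -> coprime u b ->
  u %| g R S l.
Proof.
move=> RS rE kE co; have ru := r_gt0 R; rewrite rE muln_gt0 in ru; case/andP: ru => a0 u0.
have := g_dvdl l RS; rewrite rE kE -mulnA dvdn_pmul2l // Gauss_dvdr //.
Qed.

Lemma c_part_sum R a b u : r R = a * u -> k = a * b -> coprime u b ->
  b * \sum_j c R j %/ u = (a * u).-1.
Proof.
move=> rE kE co; have ru := r_gt0 R; rewrite rE in ru.
have := c_sum R; rewrite rE kE => E; apply/eqP; rewrite -(eqn_pmul2l ru) -E.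
have -> : \sum_j c R j = u * \sum_j c R j %/ u.
  rewrite big_distrr; apply: eq_bigr => j _ /=.
  by case: (c_part j rE kE co).
by apply/eqP; ring.
Qed.

(** Write g = u e. Then the e sum to [a], and [g_sqr] says that the displayed quantity is u times
    the sum of the squares of the e, which is at least u a. *)
Lemma large_part R S a b u : R != S -> r S = k -> r R = a * u -> k = a * b ->
  coprime u b ->
  u %| a + \sum_j (c R j %/ u) * c S j /\
  a * u <= a + \sum_j (c R j %/ u) * c S j.
Proof.
move=> RS rS rE kE co; have ru := r_gt0 R; rewrite rE muln_gt0 in ru.
case/andP: ru => a0 u0.
pose e l := g R S l %/ u.
have gE l : g R S l = u * e l.
  by rewrite mulnC divnK //; apply: g_part kE co.
have se : \sum_l e l = a.
  have := g_sum RS; under eq_bigr do rewrite gE.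
  rewrite -big_distrr /= rE rS => /eqP; rewrite mulnC eqn_pmul2r // mulnC eqn_pmul2r //.
  by move/eqP.
have : a + \sum_j (c R j %/ u) * c S j = u * \sum_l e l ^ 2.
  have := g_sqr RS; rewrite rE rS (mulnC _ k) -mulnDr => /eqP.
  rewrite eqn_pmul2l // => /eqP E; apply/eqP; rewrite -(eqn_pmul2l u0); apply/eqP.
  transitivity (\sum_l g R S l ^ 2); last first.
    under eq_bigr do rewrite gE expnMn; rewrite -big_distrr /= mulnA mulnn //.
  rewrite -E mulnDr (mulnC u); congr (_ + _); rewrite big_distrr.
  by apply: eq_bigr => j _ /=; rewrite mulnA; case: (c_part j rE kE co) => <-.
move=> ->; rewrite dvdn_mulr // mulnC leq_pmul2l // -[X in X <= _]se; split=> //.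
by apply: leq_sum => l _; rewrite -mulnn; nia.
Qed.

(** * Two relations of special valency, all the others having valency k *)

Section TwoExceptions.

Variables (R1 R2 : I) (a b u v : nat).
Hypothesis R12 : R1 != R2.
Hypotheses (a_gt1 : 1 < a) (b_gt1 : 1 < b) (kE : k = a * b).
Hypotheses (r1E : r R1 = a * u) (r2E : r R2 = b * v).
Hypothesis uv_eq : a * u + b * v = (a * b).+1.
Hypothesis rS : forall S, S != R1 -> S != R2 -> r S = k.

(** Both this quotient and the next are exact, by [c_part]. *)
Let al j := c R1 j %/ u.
Let ga j := c R2 j %/ v.

(** A common divisor of [u] and [b] divides both a b and a b + 1. *)
Lemma coprime_ub : coprime u b.
Proof.
rewrite /coprime -dvdn1 -(@dvdn_addr (a * b)); last by rewrite dvdn_mull ?dvdn_gcdr.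
rewrite addn1 -uv_eq dvdn_add //; first exact/dvdn_mull/dvdn_gcdl.
exact/dvdn_mulr/dvdn_gcdr.
Qed.

Lemma coprime_va : coprime v a.
Proof.
rewrite /coprime -dvdn1 -(@dvdn_addr (a * b)); last by rewrite dvdn_mulr ?dvdn_gcdr.
rewrite addn1 -uv_eq dvdn_add //; first exact/dvdn_mulr/dvdn_gcdr.
exact/dvdn_mull/dvdn_gcdl.
Qed.

Let kE' : k = b * a. Proof. by rewrite mulnC. Qed.

Lemma uv_gt0 : 0 < u /\ 0 < v.
Proof. by have := r_gt0 R1; have := r_gt0 R2; rewrite r1E r2E !muln_gt0; lia. Qed.

Lemma al_sum : \sum_j al j + v = a.
Proof.
have := c_part_sum r1E kE coprime_ub; rewrite -/(al _) => E.
have [u0 v0] := uv_gt0; apply/eqP; rewrite -(eqn_pmul2l (ltnW b_gt1)) mulnDr E.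
have : 0 < a * u by nia.
by move=> au0; move: uv_eq; rewrite (mulnC b a); lia.
Qed.

Lemma ga_sum : \sum_j ga j + u = b.
Proof.
have := c_part_sum r2E kE' coprime_va; rewrite -/(ga _) => E.
have [u0 v0] := uv_gt0; apply/eqP; rewrite -(eqn_pmul2l (ltnW a_gt1)) mulnDr E.
have : 0 < b * v by nia.
by move=> au0; move: uv_eq; lia.
Qed.

Lemma exists_other : exists S, S != R1 /\ S != R2.
Proof.
have [S] : exists S, S \notin [set R1; R2].
  apply/existsP; rewrite -negb_forall; apply/negP=> /forallP full.
  have : #|I| <= #|[set R1; R2]|.
    by apply/subset_leq_card/subsetP=> S _; apply: full.
  by rewrite cardI cards2 R12; lia.
by rewrite !inE negb_or => /andP[? ?]; exists S.
Qed.

Lemma diag_sum j :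
  b * al j + a * ga j + \sum_(S | (S != R1) && (S != R2)) c S j = k.-1.
Proof.
rewrite -(h_sum j) [RHS](bigD1 R1) //= [X in _ = _ + X](bigD1 R2) 1?eq_sym //= addnA.
have [_ ->] := c_part j r1E kE coprime_ub; have [_ ->] := c_part j r2E kE' coprime_va.
congr (_ + _); apply: eq_bigr => S /andP[S1 S2].
by have := hc S j; rewrite rS // => /eqP; rewrite eqn_pmul2l // => /eqP.
Qed.

Lemma g_exceptional : u * v * (1 + \sum_j al j * ga j) = \sum_l g R1 R2 l ^ 2 /\
  \sum_l g R1 R2 l = u * v.
Proof.
have := g_sqr R12; have := g_sum R12.
have -> : r R1 * r R2 = k * (u * v) by rewrite r1E r2E kE; ring.
move=> /eqP; rewrite eqn_pmul2l // => /eqP gs; rewrite -mulnDr => /eqP.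
rewrite eqn_pmul2l // => /eqP E; split=> //; rewrite -E mulnDr muln1; congr (_ + _).
rewrite big_distrr; apply: eq_bigr => j _ /=.
have [-> _] := c_part j r1E kE coprime_ub; have [-> _] := c_part j r2E kE' coprime_va.
by rewrite -/(al j) -/(ga j); ring.
Qed.

(** Put A = a - v and G = b - u, the sums of [al] and [ga]. By [uv_eq], u v - 1 = A G, so the
    hypothesis is the equality case in which [al] and [ga] are both concentrated at one index [j0].
    There [diag_sum] leaves nothing for the other relations, and [large_part] yields u = v = 1,
    whence (a - 1) (b - 1) = 0. *)
Lemma aligned_absurd : (\sum_j al j * ga j).+1 = u * v -> False.
Proof.
have [u0 v0] := uv_gt0; move=> E; have sa := al_sum; have sg := ga_sum.
set A := \sum_j al j in sa; set G := \sum_j ga j in sg.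
have AG : \sum_j al j * ga j = A * G by move: uv_eq; nia.
have alA j : al j <= A by rewrite /A (bigD1 j) //= leq_addr.
have gaG j : ga j <= G by rewrite /G (bigD1 j) //= leq_addr.
have ga0 : 0 < G by move: uv_eq; nia.
have al0 : 0 < A by move: uv_eq; nia.
have eqG j : 0 < al j -> ga j = G.
  move=> aj; apply/eqP; rewrite eqn_leq gaG leqNgt; apply/negP=> lt.
  suff : \sum_j al j * ga j < A * G by rewrite AG ltnn.
  rewrite /A big_distrl /= (bigD1 j) //= [X in _ < X](bigD1 j) //= -addSn leq_add //.
    by rewrite ltn_pmul2l.
  by apply: leq_sum => i _; rewrite leq_mul2l gaG orbT.
have eqA j : 0 < ga j -> al j = A.
  move=> gj; apply/eqP; rewrite eqn_leq alA leqNgt; apply/negP=> lt.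
  suff : \sum_j al j * ga j < A * G by rewrite AG ltnn.
  rewrite /G big_distrr /= (bigD1 j) //= [X in _ < X](bigD1 j) //= -addSn leq_add //.
    by rewrite ltn_pmul2r.
  by apply: leq_sum => i _; rewrite leq_mul2r alA orbT.
have [j0 gj0] : exists j, 0 < ga j.
  apply/existsP; apply: contraT; rewrite negb_exists => /forallP g0.
  by move: ga0; rewrite /G big1 // => j _; have := g0 j; rewrite -eqn0Ngt => /eqP.
have aj0 : al j0 = A by apply: eqA.
have gj0' : ga j0 = G by apply: eqG; rewrite aj0.
have [S [S1 S2]] := exists_other.
(* The two exceptional terms already give b A + a G = a b - 1 = k - 1. *)
have cS : c S j0 = 0.
  have := diag_sum j0; rewrite aj0 gj0' (bigD1 S) ?S1 //= kE.
  by move: sa sg uv_eq; nia.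
have rest (f : J -> nat) j : f j = \sum_i f i -> forall i, i != j -> f i = 0.
  move=> fE i ij; move: fE; rewrite (bigD1 j) //= (bigD1 i) //=; lia.
have S1' : R1 != S by rewrite eq_sym.
have S2' : R2 != S by rewrite eq_sym.
have v1 : v = 1.
  have [_] := large_part S2' (rS S1 S2) r2E kE' coprime_va.
  rewrite big1; last first.
    move=> j _; have [->|jj] := eqVneq j j0; first by rewrite cS muln0.
    by rewrite -/(ga j) (rest ga j0).
  by move: b_gt1; nia.
have u1 : u = 1.
  have [_] := large_part S1' (rS S1 S2) r1E kE coprime_ub.
  rewrite big1; last first.
    move=> j _; have [->|jj] := eqVneq j j0; first by rewrite cS muln0.
    by rewrite -/(al j) (rest al j0).
  by move: a_gt1; nia.
by move: uv_eq a_gt1 b_gt1; rewrite u1 v1; nia.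
Qed.

(** Each g is divisible by u v, which is also their sum. So a single g is nonzero, the sum of
    squares is (u v)^2, and [g_exceptional] reduces to the hypothesis of [aligned_absurd]. *)
Lemma coprime_absurd : coprime u v -> False.
Proof.
move=> co; have [u0 v0] := uv_gt0; have [E gs] := g_exceptional; apply: aligned_absurd.
have R21 : R2 != R1 by rewrite eq_sym.
pose e l := g R1 R2 l %/ (u * v).
have gE l : g R1 R2 l = u * v * e l.
  rewrite mulnC divnK // Gauss_dvd // (g_part l R12 r1E kE coprime_ub) /=.
  have := g_dvdr l R12; rewrite r2E kE' -mulnA dvdn_pmul2l ?(ltnW b_gt1) //.
  by rewrite Gauss_dvdr // coprime_va.
have uv0 : 0 < u * v by rewrite muln_gt0 u0.
have se : \sum_l e l = 1.
  move: gs; under eq_bigr do rewrite gE; rewrite -big_distrr /= => /eqP.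
  by rewrite -{2}[u * v]muln1 eqn_pmul2l // => /eqP.
have : \sum_l e l ^ 2 = 1.
  rewrite -[RHS]se; apply: eq_bigr => l _.
  have : e l <= 1 by rewrite -se (bigD1 l) //= leq_addr.
  by case: (e l) => [|[|]].
move=> se2; move: E; under [RHS]eq_bigr do rewrite gE expnMn.
rewrite -big_distrr /= se2 muln1 -mulnn => /eqP; rewrite eqn_pmul2l // => /eqP.
by rewrite add1n.
Qed.

(** Here [v] is even and divides each g, and the quotients sum to 2. A single quotient 2 is the
    aligned case. Two quotients 1 concentrate [ga] at some [j0], where the other relations have
    coefficients of sum 3 v, each at least 3 v - 3; this bounds their number and finally fixes all
    parameters. *)
Lemma three_absurd : b = 3 -> u = 2 -> prime (d * k).+1 -> False.
Proof.
move=> b3 u2 p_pr; have [u0 v0] := uv_gt0.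
have [ev|] := boolP (2 %| v); last first.
  by rewrite -prime_coprime // -u2; apply: coprime_absurd.
have [E gs] := g_exceptional; have R21 : R2 != R1 by rewrite eq_sym.
pose e l := g R1 R2 l %/ v.
have gE l : g R1 R2 l = v * e l.
  rewrite mulnC divnK //.
  have := g_dvdr l R12; rewrite r2E kE' -mulnA dvdn_pmul2l ?(ltnW b_gt1) //.
  by rewrite Gauss_dvdr // coprime_va.
have se : \sum_l e l = 2.
  move: gs; under eq_bigr do rewrite gE; rewrite -big_distrr /= u2 mulnC => /eqP.
  by rewrite eqn_pmul2r // => /eqP.
have [/existsP[l el]|/existsPn el] := boolP [exists l, 1 < e l].
  have el2 : e l = 2 by apply/eqP; rewrite eqn_leq el andbT -[X in _ <= X]se (bigD1 l) //= leq_addr.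
  have se2 : \sum_l e l ^ 2 = 4.
    move: se; rewrite (bigD1 l) //= el2 => /eqP; rewrite -{2}[2]addn0 eqn_add2l.
    rewrite sum_nat_eq0 => /forall_inP e0.
    by rewrite (bigD1 l) //= el2 big1 // => i /e0/eqP ->.
  apply: aligned_absurd; move: E; under [RHS]eq_bigr do rewrite gE expnMn.
  rewrite -big_distrr /= se2 u2 -mulnn => E.
  by move: v0 E; nia.
have se2 : \sum_l e l ^ 2 = 2.
  rewrite -[RHS]se; apply: eq_bigr => l _.
  by have := el l; case: (e l) => [|[|]].
have Eag : (\sum_j al j * ga j).+1 = v.
  move: E; under [RHS]eq_bigr do rewrite gE expnMn.
  rewrite -big_distrr /= se2 u2 -mulnn => E.
  by move: v0 E; nia.
have sg : \sum_j ga j = 1 by have := ga_sum; rewrite b3 u2; lia.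
have [j0 gj0] : exists j, ga j != 0.
  apply/existsP; apply: contraT; rewrite negb_exists => /forallP g0.
  by move: sg; rewrite big1 // => j _; have := g0 j; rewrite negbK => /eqP.
have gj1 : ga j0 = 1 /\ forall j, j != j0 -> ga j = 0.
  move: sg; rewrite (bigD1 j0) //= => sg.
  split=> [|j jj]; first by move: gj0 sg; lia.
  by move: gj0 sg; rewrite (bigD1 j) //=; lia.
case: gj1 => gj1 gj.
have aj0 : (al j0).+1 = v.
  rewrite -Eag (bigD1 j0) //= gj1 muln1 big1 ?addn0 // => j /gj ->.
  by rewrite muln0.
have aE : a = 3 * v - 1 by move: uv_eq; rewrite b3 u2; lia.
have sS := diag_sum j0; rewrite gj1 b3 kE b3 in sS.
have cS S : S != R1 -> S != R2 -> v %| 3 + c S j0 /\ 3 * v <= 3 + c S j0.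
  move=> S1 S2; have S2' : R2 != S by rewrite eq_sym.
  have := large_part S2' (rS S1 S2) r2E kE' coprime_va.
  rewrite (bigD1 j0) //= -/(ga j0) gj1 mul1n big1 ?addn0 ?b3 //.
  by move=> j /gj; rewrite -/(ga j) => ->.
have [S [S1 S2]] := exists_other.
rewrite (bigD1 S) ?S1 //= in sS.
have [vS leS] := cS S S1 S2.
(* Two other relations give 2 (3 v - 3) <= 3 v, so v = 2; a third one would exceed the sum. If there
   is only one, [c S j0] = 3 v and v divides 3, against its parity. *)
have [/existsP[T /and3P[T1 T2 TS]]|/existsPn none] :=
    boolP [exists T, [&& T != R1, T != R2 & T != S]].
  rewrite (bigD1 T) ?T1 ?T2 //= in sS.
  have [vT leT] := cS T T1 T2.
  have v2 : v = 2.
    case/dvdnP: ev => x xE; move: sS; set rest := (\sum_(_ | _) _); clearbody rest.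
    by clear -xE aj0 aE leS leT v0; lia.
  have d3 : d = 3.
    have [/existsP[U /and4P[U1 U2 US UT]]|/existsPn none] :=
        boolP [exists T', [&& T' != R1, T' != R2, T' != S & T' != T]].
      rewrite (bigD1 U) ?U1 ?U2 ?US //= in sS.
      have [_ leU] := cS U U1 U2; exfalso; move: sS.
      set rest := (\sum_(_ | _) _); clearbody rest.
      by clear -aj0 aE leS leT leU v2; lia.
    have : #|I| = #|[set R1; R2; S; T]|.
      apply: eq_card => x; rewrite !inE; have := none x.
      by rewrite !negb_and !negbK; case: (x == R1) (x == R2) (x == S) (x == T) => [] [] [] [].
    have : #|[set R1; R2; S; T]| = 4.
      rewrite (setUC _ [set T]) cardsU1 !inE (negbTE T1) (negbTE T2) (negbTE TS) /=.
      rewrite (setUC _ [set S]) cardsU1 !inE (negbTE S1) (negbTE S2) /=.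
      by rewrite cards2 R12.
    by rewrite cardI => -> [].
  (* Here a = 5 and k = 15, so d k + 1 = 46 is not prime. *)
  by move: p_pr; rewrite d3 kE aE b3 v2.
have rest0 : \sum_(T | (T != R1) && (T != R2) && (T != S)) c T j0 = 0.
  by apply: big1 => T /andP[/andP[T1 T2] TS]; have := none T; rewrite T1 T2 TS.
rewrite rest0 addn0 in sS.
have : v %| 3.
  have : c S j0 = 3 * v by move: sS aj0 aE; lia.
  by move=> cE; move: vS; rewrite cE dvdn_addl // dvdn_mull.
by case/dvdnP: ev => x -> /dvdnP[y]; lia.
Qed.

End TwoExceptions.

(** [prime_part] gives one relation for each of [a] and [b]. If they coincide, all other valencies
    are multiples of k. If not, the total d k + 1 forces the configuration of the two exceptional
    relations, and [cases] selects the contradiction. *)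
Lemma thin_two a b qa ta qb tb : prime qa -> 0 < ta -> a = qa ^ ta ->
  prime qb -> 0 < tb -> b = qb ^ tb -> coprime a b -> k = a * b ->
  (forall u v, a * u + b * v = (a * b).+1 -> 0 < u < b -> 0 < v < a ->
     coprime u v \/ (b = 3 /\ u = 2)) ->
  prime (d * k).+1 -> exists R, r R = 1.
Proof.
move=> qa_pr ta0 aE qb_pr tb0 bE co kE cases p_pr.
have a1 : 1 < a by rewrite aE -(exp1n ta) ltn_exp2r ?prime_gt1.
have b1 : 1 < b by rewrite bE -(exp1n tb) ltn_exp2r ?prime_gt1.
have [|R2 aR2 aS] := prime_part qa_pr ta0; first by rewrite -aE kE dvdn_mulr.
have [|R1 bR1 bS] := prime_part qb_pr tb0; first by rewrite -bE kE dvdn_mull.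
rewrite -aE -bE in aR2 aS bR1 bS.
have [E|R12] := eqVneq R1 R2.
  exists R2; apply: thin_if_large => S S2; apply: dvdn_leq => //.
  by rewrite kE Gauss_dvd // aS // bS ?E.
have R21 : R2 != R1 by rewrite eq_sym.
have /dvdnP[u r1E] := aS _ R12; have /dvdnP[v r2E] := bS _ R21.
rewrite mulnC in r1E; rewrite mulnC in r2E.
have kS S : S != R1 -> S != R2 -> k %| r S.
  by move=> S1 S2; rewrite kE Gauss_dvd // aS // bS.
have sum_ge : \sum_(S | (S != R1) && (S != R2)) r S >= d.-1 * k.
  apply: leq_trans (_ : \sum_(S | (S != R1) && (S != R2)) k <= _).
    by rewrite sum_nat_const card_other.
  by apply: leq_sum => S /andP[S1 S2]; rewrite dvdn_leq ?kS.
have sumE : r R1 + r R2 + \sum_(S | (S != R1) && (S != R2)) r S = (d * k).+1.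
  by rewrite -r_sum [RHS](bigD1 R1) //= [X in _ = _ + X](bigD1 R2) //= addnA.
have r1 := r_gt0 R1; have r2 := r_gt0 R2.
have dvd12 : k %| (r R1 + r R2).-1.
  rewrite kE Gauss_dvd //; apply/andP; split.
    by rewrite -(prednK r2) addnS /= dvdn_add // r1E dvdn_mulr.
  by rewrite -(prednK r1) addSn /= dvdn_add // r2E dvdn_mulr.
(* The sum of the two valencies is 1 modulo k and at least 2, hence at least k + 1; the d - 1
   remaining valencies, each at least k, leave no more than that. *)
have r12 : a * u + b * v = (a * b).+1.
  have : k <= (r R1 + r R2).-1 by rewrite dvdn_leq //; lia.
  by rewrite -r1E -r2E -kE; move: sumE sum_ge d_gt1; case: (d) => // d' /=; lia.
have rS S : S != R1 -> S != R2 -> r S = k.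
  move=> S1 S2; apply/eqP; rewrite eqn_leq (dvdn_leq _ (kS S S1 S2)) // andbT leqNgt.
  apply/negP=> lt; suff : d.-1 * k < \sum_(S | (S != R1) && (S != R2)) r S.
    by move: sumE; rewrite r1E r2E r12 -kE; case: (d) d_gt1 => //= d' _; lia.
  apply: leq_trans (_ : \sum_(S | (S != R1) && (S != R2)) k < _).
    by rewrite ltnS sum_nat_const card_other.
  rewrite (bigD1 S) ?S1 //= [X in _ < X](bigD1 S) ?S1 //= -addSn leq_add //.
  by apply: leq_sum => T /andP[/andP[T1 T2] _]; rewrite dvdn_leq ?kS.
have /andP[_ u0] : (0 < a) && (0 < u) by rewrite -muln_gt0 -r1E.
have /andP[_ v0] : (0 < b) && (0 < v) by rewrite -muln_gt0 -r2E.
have ub : 0 < u < b.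
  rewrite u0 ltnNge; apply/negP=> bu; have := leq_mul (leqnn a) bu.
  by have := leq_pmulr b v0; clear -r12 b1; lia.
have va : 0 < v < a.
  rewrite v0 ltnNge; apply/negP=> av; have := leq_mul (leqnn b) av; rewrite (mulnC b a).
  by have := leq_pmulr a u0; clear -r12 a1; lia.
exfalso; case: (cases u v r12 ub va) => [co_uv|[b3 u2]].
- exact: (coprime_absurd R12 a1 b1 kE r1E r2E r12 rS co_uv).
- exact: (three_absurd R12 a1 b1 kE r1E r2E r12 rS b3 u2 p_pr).
Qed.


Lemma thin_mul pb tb b q : prime pb -> 0 < tb -> b = pb ^ tb -> prime_power q ->
  k = b * q -> prime (d * k).+1 ->
  (forall u v, q * u + b * v = (q * b).+1 -> 0 < u < b -> 0 < v < q ->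
     coprime u v \/ (b = 3 /\ u = 2)) ->
  exists R, r R = 1.
Proof.
move=> pb_pr tb0 bE [pq [tq [pq_pr [tq0 qE]]]] kE p_pr cases.
have [E|ne] := eqVneq pq pb.
  apply: thin_prime_power; exists pb, (tb + tq); rewrite expnD addn_gt0 tb0.
  by rewrite -bE -{2}E -qE.
apply: (thin_two pq_pr tq0 qE pb_pr tb0 bE) => //; last by rewrite mulnC.
rewrite qE bE coprimeXl // coprimeXr // prime_coprime // dvdn_prime2 //.
Qed.

Lemma thin_exists : prime (d * k).+1 ->
  [\/ k ^ 2 * (k + size (primes k)) < d.+1 + 2 * k ^ 2,
      (exists q, prime_power q /\ (k = q \/ k = 2 * q \/ k = 3 * q))
    | (exists q, prime_power q /\ k = 4 * q /\ ~~ (3 %| q.+1))] ->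
  exists R, r R = 1.
Proof.
move=> p_pr [big|[q [qp kq]]|[q [qp [kq q3]]]].
- have [k1|k1] := leqP k 1.
    apply: thin_if_dvd => R; have -> : k = 1 by lia.
    have := r_sum; rewrite (bigD1 R) //=.
    have : \sum_(S | S != R) 1 <= \sum_(S | S != R) r S by apply: leq_sum.
    rewrite sum1_card cardC1 cardI /= dvdn1; have -> : k = 1 by lia.
    by rewrite muln1; have := r_gt0 R; lia.
  (* Since k >= 2, the hypothesis bounds k^2 e by d. *)
  apply: thin_many => //; move: big; move: (size _) => e.
  by rewrite -mulnn; clear -k1; nia.
- case: kq => [kq|[kq|kq]]; first by apply: thin_prime_power; rewrite kq.
    apply: (@thin_mul 2 1 2 q) => // u v _ u2 _; left.
    have -> : u = 1 by clear -u2; lia.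
    exact: coprime1n.
  apply: (@thin_mul 3 1 3 q) => // u v _ u3 _.
  have [->|u1] := eqVneq u 1; [by left; rewrite coprime1n | right; split=> //].
  by clear -u3 u1; lia.
apply: (@thin_mul 2 2 4 q) => // u v E u4 _; left.
have [->|u1] := eqVneq u 1; first exact: coprime1n.
(* The value u = 2 is excluded by parity. For u = 3 the equation becomes q + 1 = 4 v, so 3 can
   divide v only if it divides q + 1. *)
have u3 : u = 3.
  have [u2|//] : u = 2 \/ u = 3 by clear -u4 u1; lia.
  by rewrite u2 in E; clear -E; lia.
rewrite u3 prime_coprime //; apply: contra q3 => v3.
have -> : q.+1 = 4 * v by rewrite u3 in E; clear -E; lia.
exact: dvdn_mull.
Qed.

End IntersectionNumbers.

(** * Coherent configurations *)

Lemma sum_sig (T : finType) (P : {pred T}) (F : T -> nat) :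
  (forall x, x \notin P -> F x = 0) ->
  \sum_x F x = \sum_(x : {x | x \in P}) F (val x).
Proof.
move=> F0; rewrite (bigID (mem P)) /= [X in _ + X]big1 ?addn0.
  exact: (big_sub P F).
by move=> x /F0.
Qed.

Lemma ord_bij (T : finType) m : #|T| = m -> exists e : 'I_m -> T, bijective e.
Proof. by move=> <-; exists enum_val; apply: enum_val_bij. Qed.

(** Right multiplication by [U] is injective, so the coordinates of the products [B i *m U] over the
    family [A] form a row-free matrix. *)
Lemma card_le_mul (F : fieldType) n (I K : finType) (B : I -> 'M[F]_n)
    (A : K -> 'M[F]_n) (U : 'M[F]_n) (w : I -> K -> F) :
  U \in unitmx ->
  (forall x : I -> F, (\sum_i x i *: B i = 0)%R -> forall i, x i = 0%R) ->
  (forall i, B i *m U = \sum_s w i s *: A s)%R -> #|I| <= #|K|.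
Proof.
move=> uU freeB BU.
pose W : 'M[F]_(#|I|, #|K|) := (\matrix_(i, s) w (enum_val i) (enum_val s))%R.
suff : row_free W by rewrite /row_free => /eqP <-; apply: rank_leq_col.
rewrite -kermx_eq0; apply/rowV0P=> t /sub_kermxP tW; apply/rowP=> i0.
pose x i := t 0%R (enum_rank i).
have -> : t 0%R i0 = x (enum_val i0) by rewrite /x enum_valK.
rewrite mxE; apply: freeB; rewrite -[LHS](mulmxK uU) mulmx_suml.
rewrite [X in (X *m _)%R](_ : _ = 0%R) ?mul0mx //.
under eq_bigr => i _ do rewrite -scalemxAl BU scaler_sumr.
rewrite exchange_big big1 //= => s _.
under eq_bigr => i _ do rewrite scalerA; rewrite -scaler_suml.
rewrite [X in (X *: _)%R](_ : _ = 0%R) ?scale0r //.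
have := congr1 (fun M : 'rV_#|K| => M 0%R (enum_rank s)) tW; rewrite [RHS]mxE.
apply: etrans; rewrite mxE (reindex (enum_val : 'I_#|I| -> I)); last first.
  by apply: onW_bij; apply: enum_val_bij.
by apply: eq_bigr => i _; rewrite /x mxE enum_valK enum_rankK.
Qed.

Section Configuration.

Variables (V : finType) (Rel : {set {set V * V}}).
Hypothesis partR : partition Rel [set: V * V].
Hypothesis trR : forall R, R \in Rel -> transpose_rel R \in Rel.
Hypothesis cohR : forall R S T, R \in Rel -> S \in Rel -> T \in Rel ->
  exists c : nat, forall u v, (u, v) \in T ->
    #|[set z | ((u, z) \in R) && ((z, v) \in S)]| = c.

Implicit Types (R S T : {set V * V}) (X Y Z : {set V}) (u v w x y z : V).

Definition adj R u v : nat := ((u, v) \in R).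

(** An entry of the product of two adjacency matrices. *)
Definition paths2 R S u v : nat := \sum_z adj R u z * adj S z v.

Definition deg R u : nat := \sum_v adj R u v.

Notation "R ^t" := (transpose_rel R) (at level 2, format "R ^t").

Lemma mem_tr R u v : ((u, v) \in R^t) = ((v, u) \in R).
Proof.
apply/imsetP/idP => [[[a b] ab [-> ->]]//|vu]; by exists (v, u).
Qed.

Lemma adj_tr R u v : adj R^t u v = adj R v u.
Proof. by rewrite /adj mem_tr. Qed.

Lemma trK : involutive (@transpose_rel V).
Proof. by move=> R; apply/setP=> -[u v]; rewrite !mem_tr. Qed.

Lemma mem_diag X u v : ((u, v) \in diag_set X) = (u == v) && (u \in X).
Proof.
apply/imsetP/andP => [[x xX [-> ->]]|[/eqP <- uX]]; first by rewrite eqxx.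
by exists u.
Qed.

Lemma tr_diag X : (diag_set X)^t = diag_set X.
Proof.
by apply/setP=> -[u v]; rewrite mem_tr !mem_diag eq_sym; case: eqP => // ->.
Qed.

Lemma paths2E R S u v : paths2 R S u v = #|[set z | ((u, z) \in R) && ((z, v) \in S)]|.
Proof.
rewrite -sum1_card big_mkcond /=; apply: eq_bigr => z _.
by rewrite inE /adj; case: (_ \in R); case: (_ \in S).
Qed.

Lemma paths2_const R S T u v u' v' : R \in Rel -> S \in Rel -> T \in Rel ->
  (u, v) \in T -> (u', v') \in T -> paths2 R S u v = paths2 R S u' v'.
Proof.
move=> HR HS HT uv uv'; have [c Hc] := cohR HR HS HT.
by rewrite !paths2E !Hc.
Qed.

Lemma paths2_tr R S u v : paths2 R^t S^t u v = paths2 S R v u.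
Proof. by apply: eq_bigr => z _; rewrite !adj_tr mulnC. Qed.

Lemma relP u v : exists2 T, T \in Rel & (u, v) \in T.
Proof.
have : (u, v) \in cover Rel by rewrite (cover_partition partR) inE.
by case/bigcupP=> T; exists T.
Qed.

Lemma rel_inj R S u v : R \in Rel -> S \in Rel ->
  (u, v) \in R -> (u, v) \in S -> R = S.
Proof.
move=> HR HS uR uS; case/and3P: partR => _ tI _.
by rewrite -(def_pblock tI HR uR) (def_pblock tI HS uS).
Qed.

Lemma rel_ex R : R \in Rel -> exists uv, uv \in R.
Proof.
move=> HR; apply/set0Pn; apply: contraTneq HR => ->.
by case/and3P: partR.
Qed.

Definition isfiber X := fiber Rel X.
Definition rels X Y := {R | R \in rels_between Rel X Y}.

Lemma relsP X Y (R : rels X Y) : val R \in Rel.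
Proof. by case: R => R /=; rewrite inE => /andP[]. Qed.

Lemma rels_sub X Y (R : rels X Y) u v : (u, v) \in val R -> u \in X /\ v \in Y.
Proof.
case: R => R /=; rewrite inE => /andP[_ /subsetP sR] /sR.
by rewrite inE => /andP[].
Qed.

Lemma adj_support X Y (R : rels X Y) u v : adj (val R) u v = (u \in X) * (v \in Y) * adj (val R) u v.
Proof.
rewrite /adj; case: (boolP (_ \in val R)) => [/rels_sub[-> ->]//|_].
by rewrite muln0.
Qed.

Lemma adj0l X Y (R : rels X Y) u v : u \notin X -> adj (val R) u v = 0.
Proof. by rewrite adj_support => /negbTE ->. Qed.

Lemma adj0r X Y (R : rels X Y) u v : v \notin Y -> adj (val R) u v = 0.
Proof. by rewrite adj_support => /negbTE ->; rewrite muln0. Qed.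

Lemma paths2_diagl X R u v : u \in X -> paths2 (diag_set X) R u v = adj R u v.
Proof.
move=> uX; rewrite /paths2 (bigD1 u) //= big1 ?addn0.
  by rewrite /adj mem_diag eqxx uX mul1n.
by move=> z zu; rewrite /adj mem_diag eq_sym (negbTE zu).
Qed.

(** The number of paths through [diag_set X] followed by [R] is constant on [R], and is 1 exactly
    when the starting point lies in [X]. *)
Lemma fiber_sub X R u v u' v' : isfiber X -> R \in Rel ->
  (u, v) \in R -> (u', v') \in R -> u \in X -> u' \in X.
Proof.
move=> fX HR uv uv' uX; have := paths2_const fX HR HR uv uv'.
rewrite paths2_diagl // /adj uv paths2E => /esym E.
have /card_gt0P[z] : 0 < #|[set z | ((u', z) \in diag_set X) && ((z, v') \in R)]| by rewrite E.
by rewrite inE mem_diag => /andP[/andP[]].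
Qed.

Lemma between X Y u v R : isfiber X -> isfiber Y -> R \in Rel -> (u, v) \in R ->
  u \in X -> v \in Y -> R \in rels_between Rel X Y.
Proof.
move=> fX fY HR uv uX vY; rewrite inE HR; apply/subsetP=> -[u' v'] uv'.
rewrite inE /= (fiber_sub fX HR uv uv') //.
by apply: (fiber_sub fY (trR HR)) vY; rewrite mem_tr; [exact: uv|exact: uv'].
Qed.

Lemma rels_at X Y x y : isfiber X -> isfiber Y -> x \in X -> y \in Y ->
  exists R0 : rels X Y, forall R : rels X Y, adj (val R) x y = (R == R0).
Proof.
move=> fX fY xX yY; have [T HT xyT] := relP x y.
pose R0 : rels X Y := Sub T (between fX fY HT xyT xX yY).
exists R0 => R; rewrite /adj; congr (nat_of_bool _); apply/idP/eqP => [xyR|->//].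
by apply: val_inj; apply: (rel_inj (relsP R) HT xyR xyT).
Qed.

Lemma rels_rep X Y (R : rels X Y) : exists x y, [/\ x \in X, y \in Y & (x, y) \in val R].
Proof.
have [[x y] xy] := rel_ex (relsP R); exists x, y.
by have [? ?] := rels_sub xy.
Qed.

Lemma sum_rels X Y x y : isfiber X -> isfiber Y -> x \in X -> y \in Y ->
  \sum_(R : rels X Y) adj (val R) x y = 1.
Proof.
move=> fX fY xX yY; have [R0 HR0] := rels_at fX fY xX yY.
by under eq_bigr do rewrite HR0; rewrite -big_mkcond big_pred1_eq.
Qed.

Lemma tr_between X Y (R : rels X Y) : (val R)^t \in rels_between Rel Y X.
Proof.
rewrite inE trR ?relsP //; apply/subsetP=> -[u v]; rewrite mem_tr inE /=.
by case/rels_sub=> -> ->.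
Qed.

Definition rtr X Y (R : rels X Y) : rels Y X := Sub ((val R)^t) (tr_between R).

Lemma rtrK X Y : cancel (@rtr X Y) (@rtr Y X).
Proof. by move=> R; apply: val_inj; rewrite /= trK. Qed.

(** The intersection number $c_{RS}^T$, read at a chosen pair of [T]; the default 0 concerns only an
    empty [T], which [Rel] does not contain. *)
Definition inum R S T : nat := if [pick uv in T] is Some uv then paths2 R S uv.1 uv.2 else 0.

Lemma inumE R S T u v : R \in Rel -> S \in Rel -> T \in Rel ->
  (u, v) \in T -> paths2 R S u v = inum R S T.
Proof.
move=> HR HS HT uv; rewrite /inum; case: pickP => [[u' v'] uv'|/(_ (u, v))].
  exact: paths2_const uv uv'.
by rewrite uv.
Qed.

Lemma deg_const X Y (R : rels X Y) x x' : isfiber X -> x \in X -> x' \in X ->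
  deg (val R) x = deg (val R) x'.
Proof.
move=> fX xX xX'.
have E u : deg (val R) u = paths2 (val R) (val R)^t u u.
  by apply: eq_bigr => v _; rewrite adj_tr /adj; case: (_ \in _).
rewrite !E; apply: (paths2_const (relsP R) (trR (relsP R)) fX); rewrite mem_diag eqxx //.
Qed.

Lemma card_rel R : #|R| = \sum_u \sum_v adj R u v.
Proof.
rewrite pair_big /= -sum1_card big_mkcond /=; apply: eq_bigr => -[u v] _.
by rewrite /adj; case: (_ \in R).
Qed.

Lemma card_deg X Y (R : rels X Y) x : isfiber X -> x \in X ->
  #|val R| = #|X| * deg (val R) x.
Proof.
move=> fX xX; rewrite card_rel (bigID (mem X)) /= [X in _ + X]big1 ?addn0.
  by rewrite -sum_nat_const; apply: eq_bigr => u uX; apply: deg_const.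
by move=> u uX; apply: big1 => v _; apply: adj0l.
Qed.

(** The valency, free of any choice of a point; [degE] identifies it with the common out-degree on a
    fiber. *)
Definition vlc X R := #|R| %/ #|X|.

Lemma degE X Y (R : rels X Y) x : isfiber X -> x \in X -> deg (val R) x = vlc X (val R).
Proof.
by move=> fX xX; rewrite /vlc (card_deg R fX xX) mulKn //; apply/card_gt0P; exists x.
Qed.

Lemma card_tr R : #|R^t| = #|R|.
Proof. by rewrite card_imset // => -[u v] [u' v'] [-> ->]. Qed.

Lemma deg_trE X Y (R : rels X Y) y : #|X| = #|Y| -> isfiber Y -> y \in Y ->
  \sum_x adj (val R) x y = vlc X (val R).
Proof.
move=> XY fY yY; rewrite /vlc -card_tr XY -[LHS](_ : deg (val (rtr R)) y = _).
  exact: (degE (rtr R)).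
by apply: eq_bigr => x _; rewrite adj_tr.
Qed.


Lemma rel_expand X Y (F : V -> V -> nat) (f : rels X Y -> nat) :
  isfiber X -> isfiber Y ->
  (forall u v, u \notin X -> F u v = 0) -> (forall u v, v \notin Y -> F u v = 0) ->
  (forall (R : rels X Y) u v, (u, v) \in val R -> F u v = f R) ->
  forall u v, F u v = \sum_(R : rels X Y) f R * adj (val R) u v.
Proof.
move=> fX fY FX FY FR u v.
have [uX|uX] := boolP (u \in X); last first.
  by rewrite FX // big1 // => R _; rewrite adj0l ?muln0.
have [vY|vY] := boolP (v \in Y); last first.
  by rewrite FY // big1 // => R _; rewrite adj0r ?muln0.
have [R0 HR0] := rels_at fX fY uX vY.
rewrite (bigD1 R0) //= HR0 eqxx muln1 big1 ?addn0.
  by apply: FR; have := HR0 R0; rewrite eqxx /adj; case: (_ \in _).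
by move=> R /negbTE RR0; rewrite HR0 RR0 muln0.
Qed.

Lemma paths2_expand X Y Z (R : rels X Y) (S : rels Y Z) u v : isfiber X -> isfiber Z ->
  paths2 (val R) (val S) u v =
  \sum_(T : rels X Z) inum (val R) (val S) (val T) * adj (val T) u v.
Proof.
move=> fX fZ.
apply: (rel_expand (F := paths2 (val R) (val S)) (f := fun T : rels X Z => inum (val R) (val S) (val T))) => //.
- by move=> {}u {}v uX; apply: big1 => z _; rewrite adj0l.
- by move=> {}u {}v vZ; apply: big1 => z _; rewrite [X in _ * X]adj0r ?muln0.
- by move=> T {}u {}v; apply: inumE; apply: relsP.
Qed.

Lemma vlc_gt0 X Y (R : rels X Y) : isfiber X -> 0 < vlc X (val R).
Proof.
move=> fX; have [x [y [xX yY xy]]] := rels_rep R.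
by rewrite -(degE R fX xX) /deg (bigD1 y) //= /adj xy.
Qed.

Lemma vlc_sum X Y : isfiber X -> isfiber Y -> 0 < #|X| ->
  \sum_(R : rels X Y) vlc X (val R) = #|Y|.
Proof.
move=> fX fY /card_gt0P[x xX].
transitivity (\sum_(R : rels X Y) \sum_y adj (val R) x y).
  by apply: eq_bigr => R _; rewrite -(degE R fX xX).
rewrite exchange_big /= -sum1_card [RHS]big_mkcond; apply: eq_bigr => y _ /=.
have [yY|yY] := boolP (y \in Y); first exact: sum_rels.
by rewrite big1 // => R _; apply: adj0r.
Qed.

Definition rdiag X (fX : isfiber X) : rels X X.
Proof.
exists (diag_set X); rewrite inE; apply/andP; split=> //; apply/subsetP=> -[u v].
by rewrite mem_diag inE /= => /andP[/eqP <- ->].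
Defined.

(** * Counting identities between two fibers of equal size *)

Section TwoFibers.

Variables X Y : {set V}.
Hypotheses (fX : isfiber X) (fY : isfiber Y) (XY : #|X| = #|Y|) (X_gt0 : 0 < #|X|).

Lemma vlc_tr (R : rels X Y) : vlc Y (val (rtr R)) = vlc X (val R).
Proof. by rewrite /vlc /= card_tr XY. Qed.

Lemma vlc_mul (R S : rels X Y) :
  \sum_(j : rels X X) vlc X (val j) * inum (val R) (val S)^t (val j) =
  vlc X (val R) * vlc X (val S).
Proof.
have /card_gt0P[x xX] := X_gt0.
transitivity (\sum_x' paths2 (val R) (val S)^t x x').
  under [RHS]eq_bigr do rewrite (paths2_expand R (rtr S)) //.
  rewrite exchange_big; apply: eq_bigr => j _ /=.
  by rewrite -(degE j fX xX) mulnC big_distrr.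
rewrite exchange_big /= -(degE R fX xX) big_distrl /=; apply: eq_bigr => y _.
have [yY|yY] := boolP (y \in Y); last by rewrite adj0r // big1.
rewrite -big_distrr /=; congr (_ * _); rewrite -(deg_trE S XY fY yY).
by apply: eq_bigr => x' _; rewrite adj_tr.
Qed.

(** With x fixed in [X], both sides count the triangles x, x', y whose sides xy, xx', x'y lie in
    [R], [j], [S]. *)
Lemma triangle_count (R S : rels X Y) (j : rels X X) :
  vlc X (val R) * inum (val j) (val S) (val R) =
  vlc X (val j) * inum (val R) (val S)^t (val j).
Proof.
have /card_gt0P[x xX] := X_gt0.
transitivity (\sum_y \sum_x' adj (val R) x y * (adj (val j) x x' * adj (val S) x' y)).
  rewrite -(degE R fX xX) big_distrl; apply: eq_bigr => y _ /=.
  rewrite -big_distrr /= /adj; case: (boolP (_ \in val R)) => // xy.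
  by rewrite !mul1n -(inumE (relsP j) (relsP S) (relsP R) xy).
rewrite exchange_big -(degE j fX xX) big_distrl; apply: eq_bigr => x' _ /=.
have [xx|xx] := boolP ((x, x') \in val j); last first.
  by rewrite /adj (negbTE xx) big1 // => y _; rewrite muln0.
rewrite /adj xx mul1n -(inumE (relsP R) (trR (relsP S)) (relsP j) xx).
by apply: eq_bigr => y _; rewrite mul1n adj_tr.
Qed.

Lemma inum_diag (R S : rels X Y) :
  inum (val R) (val S)^t (diag_set X) = (R == S) * vlc X (val R).
Proof.
have /card_gt0P[x xX] := X_gt0.
have xx : (x, x) \in diag_set X by rewrite mem_diag eqxx.
rewrite -(inumE (relsP R) (trR (relsP S)) fX xx).
have [<-|RS] := eqVneq R S.
  rewrite mul1n -(degE R fX xX); apply: eq_bigr => y _.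
  by rewrite adj_tr /adj; case: (_ \in _).
rewrite mul0n; apply: big1 => y _; rewrite adj_tr /adj.
case: (boolP (_ \in val R)) => // xR; case: (boolP (_ \in val S)) => // xS.
by case/eqP: RS; apply: val_inj; apply: rel_inj xR xS; apply: relsP.
Qed.

Lemma vlc_diag : vlc X (diag_set X) = 1.
Proof. by rewrite /vlc card_imset ?divnn ?X_gt0 // => x y []. Qed.

(** After multiplication by [#|X|], both sides count the quadruples x, x', y, y' with xy, x'y in [R]
    and xy', x'y' in [S], grouped by the pair x, x' or by the pair y, y'. *)
Lemma quadrangle_count (R S : rels X Y) :
  \sum_(j : rels X X) vlc X (val j) *
     (inum (val R) (val R)^t (val j) * inum (val S) (val S)^t (val j)) =
  \sum_(l : rels Y Y) vlc Y (val l) * inum (val R)^t (val S) (val l) ^ 2.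
Proof.
apply/eqP; rewrite -(eqn_pmul2l X_gt0); apply/eqP.
have grp (Z : {set V}) (F : V -> V -> nat) (f : rels Z Z -> nat) : isfiber Z ->
    (forall u v, F u v = \sum_(j : rels Z Z) f j * adj (val j) u v) ->
    \sum_u \sum_v F u v = #|Z| * \sum_(j : rels Z Z) vlc Z (val j) * f j.
  move=> fZ FE.
  transitivity (\sum_(j : rels Z Z) f j * #|val j|).
    under eq_bigr do under eq_bigr do rewrite FE.
    under eq_bigr do rewrite exchange_big; rewrite exchange_big /=.
    apply: eq_bigr => j _; rewrite card_rel big_distrr; apply: eq_bigr => u _ /=.
    by rewrite big_distrr.
  rewrite big_distrr; apply: eq_bigr => j _ /=.
  have [x [y [xZ _ _]]] := rels_rep j.
  by rewrite (card_deg j fZ xZ) (degE j fZ xZ); ring.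
transitivity (\sum_x \sum_x' paths2 (val R) (val R)^t x x' * paths2 (val S) (val S)^t x x').
  apply/esym/grp => //; apply: rel_expand => //.
  - by move=> u v uX; rewrite [paths2 _ _ _ _]big1 // => z _; rewrite adj0l.
  - by move=> u v vX; rewrite [paths2 _ _ _ _]big1 // => z _; rewrite adj_tr [X in _ * X]adj0l ?muln0.
  - by move=> T u v uv; congr (_ * _); apply: inumE uv; rewrite ?trR ?relsP.
transitivity (\sum_y \sum_y' paths2 (val R)^t (val S) y y' ^ 2); last first.
  rewrite XY; apply: grp => //; apply: rel_expand => //.
  - by move=> u v uX; rewrite [paths2 _ _ _ _]big1 // => z _; rewrite adj_tr adj0r.
  - by move=> u v vX; rewrite [paths2 _ _ _ _]big1 // => z _; rewrite [X in _ * X]adj0r ?muln0.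
  - by move=> T u v uv; congr (_ ^ _); apply: inumE uv; rewrite ?trR ?relsP.
pose a x y := adj (val R) x y; pose b x y := adj (val S) x y.
transitivity (\sum_x \sum_x' \sum_y \sum_y' (a x y * a x' y) * (b x y' * b x' y')).
  apply: eq_bigr => x _; apply: eq_bigr => x' _; rewrite big_distrl /=.
  apply: eq_bigr => y _; rewrite big_distrr; apply: eq_bigr => y' _ /=.
  by rewrite !adj_tr.
under eq_bigr do rewrite exchange_big; rewrite exchange_big /=.
under eq_bigr do under eq_bigr do rewrite exchange_big.
under eq_bigr do rewrite exchange_big; apply: eq_bigr => y _ /=.
apply: eq_bigr => y' _; rewrite -mulnn /paths2 big_distrl; apply: eq_bigr => x _ /=.
rewrite big_distrr; apply: eq_bigr => x' _ /=.
by rewrite !adj_tr /a /b; ring.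
Qed.

End TwoFibers.

(** * Adjacency matrices and their invertibility modulo the prime *)

Section Matrices.

Variables X Y : {set V}.
Hypotheses (fX : isfiber X) (fY : isfiber Y) (XY : #|X| = #|Y|) (X_gt0 : 0 < #|X|).

Variables (n : nat) (ex : 'I_n.+1 -> {x | x \in X}) (ey : 'I_n.+1 -> {y | y \in Y}).
Hypotheses (ex_bij : bijective ex) (ey_bij : bijective ey) (p_pr : prime n.+1).

Local Open Scope ring_scope.

Lemma sum_enum (Z : {set V}) (e : 'I_n.+1 -> {z | z \in Z}) (F : V -> nat) :
  bijective e -> (forall z, z \notin Z -> F z = 0%N) ->
  (\sum_z F z = \sum_a F (val (e a)))%N.
Proof.
move=> e_bij F0; rewrite (sum_sig (P := mem Z)) //.
by rewrite (reindex e) //; apply: onW_bij.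
Qed.

Definition amx (F : pzRingType) (Z W : {set V}) (e : 'I_n.+1 -> {z | z \in Z})
    (f : 'I_n.+1 -> {z | z \in W}) R : 'M[F]_n.+1 :=
  \matrix_(a, b) (adj R (val (e a)) (val (f b)))%:R.

Lemma amxM (F : pzRingType) (Z W U : {set V}) (e : 'I_n.+1 -> {z | z \in Z})
    (f : 'I_n.+1 -> {z | z \in W}) (g : 'I_n.+1 -> {z | z \in U})
    (R : rels Z W) (S : rels W U) : isfiber Z -> isfiber U -> bijective f ->
  amx F e f (val R) *m amx F f g (val S) =
  \sum_(T : rels Z U) (inum (val R) (val S) (val T))%:R *: amx F e g (val T).
Proof.
move=> fZ fU f_bij; apply/matrixP=> a b; rewrite !mxE summxE.
transitivity ((paths2 (val R) (val S) (val (e a)) (val (g b)))%:R : F).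
  rewrite /paths2 (sum_enum f_bij); last by move=> z zW; rewrite adj0r.
  by rewrite natr_sum; apply: eq_bigr => c _; rewrite !mxE natrM.
by rewrite paths2_expand // natr_sum; apply: eq_bigr => T _; rewrite !mxE natrM.
Qed.

Lemma amx_tr (F : pzRingType) (Z W : {set V}) (e : 'I_n.+1 -> {z | z \in Z})
    (f : 'I_n.+1 -> {z | z \in W}) R : amx F f e R^t = (amx F e f R)^T.
Proof. by apply/matrixP=> a b; rewrite !mxE adj_tr. Qed.

Lemma amx_map (F : pzRingType) (Z W : {set V}) (e : 'I_n.+1 -> {z | z \in Z})
    (f : 'I_n.+1 -> {z | z \in W}) R : map_mx intr (amx int e f R) = amx F e f R.
Proof. by apply/matrixP=> a b; rewrite !mxE rmorph_nat. Qed.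

Lemma amx_ind (F : pzRingType) (Z W : {set V}) (e : 'I_n.+1 -> {z | z \in Z})
    (f : 'I_n.+1 -> {z | z \in W}) (R : rels Z W) : bijective e -> bijective f ->
  exists a b, forall S : rels Z W, amx F e f (val S) a b = (S == R)%:R.
Proof.
move=> [e' _ eK] [f' _ fK]; have [x [y [xZ yW xy]]] := rels_rep R.
exists (e' (exist _ x xZ)), (f' (exist _ y yW)) => S.
rewrite !mxE eK fK /= /adj; congr (_%:R); congr (nat_of_bool _).
apply/idP/eqP => [xyS|->//]; apply: val_inj.
by apply: rel_inj xyS xy; apply: relsP.
Qed.

Lemma amx_free (F : fieldType) (Z W : {set V}) (e : 'I_n.+1 -> {z | z \in Z})
    (f : 'I_n.+1 -> {z | z \in W}) (x : rels Z W -> F) :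
  bijective e -> bijective f ->
  \sum_(R : rels Z W) x R *: amx F e f (val R) = 0 -> forall R : rels Z W, x R = 0.
Proof.
move=> be bf E R; have [a [b Hab]] := amx_ind F R be bf.
have := congr1 (fun A : 'M_n.+1 => A a b) E; rewrite summxE (bigD1 R) //= big1.
  by rewrite addr0 mxE Hab eqxx mulr1 mxE.
by move=> S /negbTE SR; rewrite mxE Hab SR mulr0.
Qed.

Let B (j : rels X X) := amx int ex ex (val j).
Let i0 := rdiag fX.

Lemma cardX : #|X| = n.+1.
Proof. by rewrite -card_sig -(bij_eq_card ex_bij) card_ord. Qed.

Lemma B_one : B i0 = 1%:M.
Proof.
apply/matrixP=> a b; rewrite !mxE /adj mem_diag (valP (ex a)) andbT.
by rewrite (inj_eq val_inj) (inj_eq (bij_inj ex_bij)).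
Qed.

Lemma B_mul i j : B i *m B j = \sum_l (inum (val i) (val j) (val l))%:Z *: B l.
Proof.
by rewrite /B amxM //; apply: eq_bigr => l _; rewrite natz.
Qed.

Lemma B_row i : B i *m const_mx 1 = (vlc X (val i))%:R *: const_mx 1 :> 'cV_n.+1.
Proof.
apply/matrixP=> a b; rewrite !mxE mulr1 -(degE i fX (valP (ex a))) /deg.
rewrite (sum_enum ex_bij) => [|z zX]; last by rewrite adj0r.
by rewrite natr_sum; apply: eq_bigr => c _; rewrite !mxE mulr1.
Qed.

Lemma B_tr i : \tr (B i) = if i == i0 then n.+1%:R else 0.
Proof.
have E x : x \in X -> adj (val i) x x = (i == i0).
  move=> xX; rewrite /adj; congr (nat_of_bool _).
  have xx : (x, x) \in diag_set X by rewrite mem_diag eqxx.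
  apply/idP/eqP => [xi|->//]; apply: val_inj.
  by apply: rel_inj xi xx; rewrite ?relsP.
rewrite /mxtrace; under eq_bigr => a _ do rewrite mxE E ?(valP (ex a)) //.
by case: eqP => _; rewrite sumr_const card_ord ?mul0rn.
Qed.

Lemma B_ind i : exists a b, forall j, B j a b = (j == i)%:R.
Proof. exact: amx_ind. Qed.

(* A A^T lies in the span of the relations on X, which is local modulo p, and
   its valency is nonzero modulo p. *)
Lemma amx_unit (R : rels X Y) : (1 < #|{: rels X Y}|)%N ->
  amx 'F_n.+1 ex ey (val R) \in unitmx.
Proof.
move=> many; set A := amx _ _ _ _.
have H : inA B B (fun i => vlc X (val i)) (A *m A^T)
    (A *m A^T) ((vlc X (val R) * vlc X (val R))%N%:R : 'F_n.+1).
  have E : A *m A^T = \sum_(j : rels X X)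
      (inum (val R) (val R)^t (val j))%:R *: map_mx intr (B j).
    rewrite -amx_tr (amxM _ _ _ R (rtr R)) //.
    by apply: eq_bigr => j _; rewrite amx_map.
  exists (fun j => (inum (val R) (val R)^t (val j))%:R); split=> //.
  by rewrite -(vlc_mul fX fY XY X_gt0) natr_sum; apply: eq_bigr => j _; rewrite natrM mulrC.
have : A *m A^T \in unitmx.
  apply: (inA_unit B_one B_one B_mul B_mul B_row B_row B_tr p_pr H).
  rewrite natrM mulf_eq0 orbb -(dvdn_pcharf (pchar_Fp p_pr)).
  apply/negP=> /dvdn_leq -/(_ (vlc_gt0 R fX)).
  have /card_gt0P[S] : (0 < #|[set~ R]|)%N by rewrite cardsC1; case: #|_| many => [|[]].
  rewrite !inE => SR; have := vlc_sum fX fY X_gt0; rewrite -XY cardX (bigD1 R) //=.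
  by rewrite (bigD1 S) //=; have := vlc_gt0 S fX; rewrite /=; lia.
by rewrite unitmx_mul => /andP[].
Qed.

(** Right multiplication by an invertible A_R embeds the span of the relations on [X] into that of
    the relations between [X] and [Y]; its transpose embeds the latter into the former. *)
Lemma card_relsXY : (1 < #|{: rels X Y}|)%N -> #|{: rels X X}| = #|{: rels X Y}|.
Proof.
move=> many; have [R _] : exists R : rels X Y, true.
  by have /card_gt0P[R _] := ltnW many; exists R.
have uA := amx_unit R many; apply/eqP; rewrite eqn_leq; apply/andP; split.
  apply: (card_le_mul uA) => [x|j]; first exact: (amx_free ex_bij ex_bij).
  exact: (amxM _ _ _ j R).
have uA' : amx 'F_n.+1 ey ex (val (rtr R)) \in unitmx by rewrite amx_tr unitmx_tr.
apply: (card_le_mul uA') => [x|S]; first exact: (amx_free ex_bij ey_bij).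
exact: (amxM _ _ _ S (rtr R)).
Qed.

(** * The action on the span of the relations between the fibers *)

Section Regular.

Variables (m : nat) (er : 'I_m.+1 -> rels X Y).
Hypothesis er_bij : bijective er.

(** Left multiplication by [B j] in the basis of the A_R: column [t] holds the coordinates of the
    product with A_(er t). *)
Let L (j : rels X X) : 'M[int]_m.+1 :=
  \matrix_(s, t) (inum (val j) (val (er t)) (val (er s)))%:R.

Lemma sum_er (A : nmodType) (F : rels X Y -> A) : \sum_R F R = \sum_s F (er s).
Proof. by rewrite (reindex er) //; apply: onW_bij. Qed.

Lemma L_one : L i0 = 1%:M.
Proof.
apply/matrixP=> s t; rewrite !mxE; congr (_%:R).
have [x [y [xX yY xy]]] := rels_rep (er s).
rewrite -(inumE fX (relsP _) (relsP _) xy) paths2_diagl //.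
have [R0 HR0] := rels_at fX fY xX yY.
have R0E : R0 = er s.
  by apply/eqP; have := HR0 (er s); rewrite /adj xy eq_sym; case: eqP.
by rewrite HR0 R0E (inj_eq (bij_inj er_bij)) eq_sym.
Qed.

(** Associativity: both sides count the walks x, z, w, y with steps in [i], [j] and [er t], for a
    fixed pair (x, y) of [er s]. *)
Lemma L_mul i j : L i *m L j = \sum_l (inum (val i) (val j) (val l))%:Z *: L l.
Proof.
apply/matrixP=> s t; rewrite !mxE summxE.
have [x [y [xX yY xy]]] := rels_rep (er s).
transitivity ((\sum_z \sum_w adj (val i) x z * (adj (val j) z w * adj (val (er t)) w y))%N%:R : int).
  transitivity ((\sum_(S : rels X Y)
      inum (val i) (val S) (val (er s)) * inum (val j) (val (er t)) (val S))%N%:R : int).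
    by rewrite natr_sum sum_er; apply: eq_bigr => u _; rewrite !mxE natrM.
  congr (_%:R); under [RHS]eq_bigr => z _ do
    rewrite -big_distrr /= -[X in (_ * X)%N]/(paths2 _ _ _ _) (paths2_expand j (er t)) // big_distrr.
  rewrite exchange_big; apply: eq_bigr => S _ /=.
  rewrite -(inumE (relsP i) (relsP S) (relsP (er s)) xy) /paths2 big_distrl.
  by apply: eq_bigr => z _ /=; rewrite -mulnA (mulnC (adj (val S) z y)).
rewrite exchange_big /= natr_sum.
transitivity (\sum_w (paths2 (val i) (val j) x w * adj (val (er t)) w y)%N%:R : int).
  apply: eq_bigr => w _; congr (_%:R); rewrite /paths2 big_distrl.
  by apply: eq_bigr => z _ /=; rewrite mulnA.
transitivity ((\sum_(l : rels X X)
    inum (val i) (val j) (val l) * inum (val l) (val (er t)) (val (er s)))%N%:R : int).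
  rewrite -natr_sum; congr (_%:R).
  under eq_bigr => w _ do rewrite (paths2_expand i j) // big_distrl.
  rewrite exchange_big; apply: eq_bigr => l _ /=.
  rewrite -(inumE (relsP l) (relsP (er t)) (relsP (er s)) xy) /paths2 big_distrr.
  by apply: eq_bigr => w _ /=; rewrite mulnA.
by rewrite natr_sum; apply: eq_bigr => l _; rewrite !mxE natrM natz.
Qed.

Lemma L_row i : L i *m const_mx 1 = (vlc X (val i))%:R *: const_mx 1 :> 'cV_m.+1.
Proof.
apply/matrixP=> s b; rewrite !mxE mulr1.
have [x [y [xX yY xy]]] := rels_rep (er s).
transitivity ((\sum_(S : rels X Y) inum (val i) (val S) (val (er s)))%N%:R : int).
  by rewrite natr_sum sum_er; apply: eq_bigr => u _; rewrite !mxE mulr1.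
congr (_%:R); rewrite -(degE i fX xX).
under eq_bigr => S _ do rewrite -(inumE (relsP i) (relsP S) (relsP (er s)) xy).
rewrite exchange_big; apply: eq_bigr => z _ /=.
rewrite -big_distrr /=; have [zX|zX] := boolP (z \in X); last by rewrite adj0r.
by rewrite sum_rels ?muln1.
Qed.

Lemma B_trM i j : \tr (B i *m B j) =
  if j == rtr i then (n.+1 * vlc X (val i))%N%:R else 0.
Proof.
rewrite B_mul [LHS]raddf_sum (bigD1 i0) //= big1 ?addr0; last first.
  by move=> l /negbTE li0; rewrite mxtraceZ B_tr li0 mulr0.
rewrite mxtraceZ B_tr eqxx.
have -> : inum (sval i) (sval j) (diag_set X) = ((i == rtr j) * vlc X (val i))%N.
  by rewrite -(inum_diag fX X_gt0) /= trK.
rewrite -(inj_eq (can_inj (@rtrK X X))) rtrK eq_sym.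
by case: eqP => _; rewrite ?mul0n ?mul0r // mul1n -natz -natrM mulnC.
Qed.

(** The diagonal entries agree one by one: [triangle_count] expresses them through coefficients of
    A_R A_R^T, which is symmetric. *)
Lemma L_trT i : \tr (L (rtr i)) = \tr (L i).
Proof.
apply: eq_bigr => s _; rewrite !mxE; congr (_%:R); set R := er s.
have vi : vlc X (val (rtr i)) = vlc X (val i) by rewrite /vlc /= card_tr.
apply/eqP; rewrite -(eqn_pmul2l (vlc_gt0 R fX)) !(triangle_count fX X_gt0) vi.
apply/eqP; congr (_ * _)%N; have [x [y [xX yX xy]]] := rels_rep i.
rewrite -(inumE (relsP R) (trR (relsP R)) (relsP i) xy).
rewrite -(inumE (u := y) (v := x) (relsP R) (trR (relsP R)) (relsP (rtr i))) ?mem_tr //.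
by rewrite -{1}(trK (val R)) paths2_tr.
Qed.

(** The [B i] add up to the all-ones matrix, so the diagonal entries at R add up to the in-degree of
    R, its valency. *)
Lemma L_tr_sum : \sum_i \tr (L i) = n.+1%:R.
Proof.
rewrite exchange_big /=.
transitivity (\sum_s (vlc X (val (er s)))%:R : int).
  apply: eq_bigr => s _; have [x [y [xX yY xy]]] := rels_rep (er s).
  transitivity ((\sum_(i : rels X X) inum (val i) (val (er s)) (val (er s)))%N%:R : int).
    by rewrite natr_sum; apply: eq_bigr => i _; rewrite mxE.
  congr (_%:R); rewrite -(deg_trE (er s) XY fY yY).
  under [LHS]eq_bigr => i _ do rewrite -(inumE (relsP i) (relsP (er s)) (relsP (er s)) xy).
  rewrite exchange_big; apply: eq_bigr => z _ /=; rewrite -big_distrl /=.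
  have [zX|zX] := boolP (z \in X); last by rewrite (adj0l (er s) _ zX) muln0.
  by rewrite sum_rels // mul1n.
rewrite -(sum_er (fun R : rels X Y => (vlc X (val R))%:R)) -natr_sum.
by rewrite vlc_sum // -XY cardX.
Qed.

Lemma valencies k : (1 < #|{: rels X Y}|)%N -> (k * m = n)%N ->
  forall j : rels X X, val j != diag_set X ->
  vlc X (val j) = k /\
  (\sum_(R : rels X Y) inum (val j) (val R) (val R) = k.-1)%N.
Proof.
move=> many kn j ji.
have cI : #|{: rels X X}| = m.+1.
  by rewrite card_relsXY // -(bij_eq_card er_bij) card_ord.
have vs : (\sum_(j : rels X X) vlc X (val j) = n.+1)%N by rewrite vlc_sum // cardX.
have [|vk tk] := prime_valencies B_one L_one B_mul L_mul B_row L_row B_tr B_ind p_pr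
   (@rtrK X X) B_trM (fun j => vlc_gt0 j fX) vs L_trT L_tr_sum kn cI (i := j).
  by apply: contra ji => /eqP ->.
split=> //.
have : ((\sum_(R : rels X Y) inum (val j) (val R) (val R))%N%:R : int) = k%:Z - 1.
  by rewrite -tk natr_sum sum_er; apply: eq_bigr => s _; rewrite mxE.
by have := vlc_gt0 j fX; rewrite vk natz; lia.
Qed.

End Regular.

End Matrices.

Lemma sum_offdiag (T : finType) (i0 : T) (F : T -> nat) :
  \sum_i F i = F i0 + \sum_(i : {i | i \in predC1 i0}) F (val i).
Proof. by rewrite (bigD1 i0) //=; congr (_ + _); apply: (big_sub (predC1 i0) F). Qed.

(** * Fibers of prime size, without reference to enumerations *)

Section PrimeFibers.

Variables X Y : {set V}.
Hypotheses (fX : isfiber X) (fY : isfiber Y) (XY : #|X| = #|Y|) (p_pr : prime #|X|).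
Hypothesis many : 1 < #|{: rels X Y}|.

Lemma enum_fibers : exists n (ex : 'I_n.+1 -> {x | x \in X}) (ey : 'I_n.+1 -> {y | y \in Y}),
  [/\ #|X| = n.+1, bijective ex & bijective ey].
Proof.
have X0 := prime_gt0 p_pr; exists #|X|.-1.
have [ex ex_bij] : exists e : 'I_#|X|.-1.+1 -> {x | x \in X}, bijective e.
  by apply: ord_bij; rewrite card_sig prednK.
have [ey ey_bij] : exists e : 'I_#|X|.-1.+1 -> {y | y \in Y}, bijective e.
  by apply: ord_bij; rewrite card_sig -XY prednK.
by exists ex, ey; split=> //; rewrite prednK.
Qed.

Lemma card_prime_rels : #|{: rels X X}| = #|{: rels X Y}|.
Proof.
have [n [ex [ey [Xn ex_bij ey_bij]]]] := enum_fibers.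
have p_pr' : prime n.+1 by rewrite -Xn.
exact: (card_relsXY fX fY XY (prime_gt0 p_pr) ex_bij ey_bij p_pr' many).
Qed.

Lemma prime_fiber_valencies k : k * #|{: rels X X}|.-1 = #|X|.-1 ->
  forall j : rels X X, j != rdiag fX -> vlc X (val j) = k /\
    \sum_(R : rels X Y) inum (val j) (val R) (val R) = k.-1.
Proof.
move=> kE j ji.
have [n [ex [ey [Xn ex_bij ey_bij]]]] := enum_fibers.
have p_pr' : prime n.+1 by rewrite -Xn.
have [er er_bij] : exists e : 'I_#|{: rels X Y}|.-1.+1 -> rels X Y, bijective e.
  by apply: ord_bij; rewrite prednK // ltnW.
apply: (valencies fX fY XY (prime_gt0 p_pr) ex_bij ey_bij p_pr' er_bij many).
  by rewrite -card_prime_rels kE Xn.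
by apply: contra ji => /eqP E; apply/eqP/val_inj.
Qed.

End PrimeFibers.

Lemma card_rels_tr X Y : #|{: rels X Y}| = #|{: rels Y X}|.
Proof. by apply: (bij_eq_card (f := @rtr X Y)); exists (@rtr Y X); apply: rtrK. Qed.

(** * Existence of a relation of valency 1 *)

Section Thin.

Variables (X Y : {set V}) (k : nat).
Hypotheses (fX : isfiber X) (fY : isfiber Y) (XY : #|X| = #|Y|) (p_pr : prime #|X|).
Hypothesis XX2 : 2 < #|{: rels X X}|.
Hypothesis XY1 : 1 < #|{: rels X Y}|.
Hypothesis kE : k * #|{: rels X X}|.-1 = #|X|.-1.

Let d := #|{: rels X X}|.-1.
Let X0 : 0 < #|X| := prime_gt0 p_pr.
Let Y0 : 0 < #|Y|. Proof. by rewrite -XY. Qed.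
Let YX1 : 1 < #|{: rels Y X}|. Proof. by rewrite -card_rels_tr. Qed.

Lemma vlcX (j : rels X X) : j != rdiag fX -> vlc X (val j) = k.
Proof. by move=> ji; have [] := prime_fiber_valencies fY XY p_pr XY1 kE ji. Qed.

Lemma vlcY (l : rels Y Y) : l != rdiag fY -> vlc Y (val l) = k.
Proof.
have pY : prime #|Y| by rewrite -XY.
move=> li; have [|] := prime_fiber_valencies fX (esym XY) pY YX1 _ li (k := k) => //.
rewrite (card_prime_rels fY fX (esym XY) pY YX1) -card_rels_tr -XY.
by rewrite -(card_prime_rels fX fY XY p_pr XY1).
Qed.

Lemma thin_relation :
  [\/ k ^ 2 * (k + size (primes k)) < d.+1 + 2 * k ^ 2,
      (exists q, prime_power q /\ (k = q \/ k = 2 * q \/ k = 3 * q))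
    | (exists q, prime_power q /\ k = 4 * q /\ ~~ (3 %| q.+1))] ->
  exists R : rels X Y, vlc X (val R) = 1.
Proof.
have dk : (d * k).+1 = #|X| by rewrite mulnC kE prednK.
have cXY := card_prime_rels fX fY XY p_pr XY1.
pose J := {j : rels X X | j \in predC1 (rdiag fX)}; pose K := {l : rels Y Y | l \in predC1 (rdiag fY)}.
pose c (R : rels X Y) (j : J) := inum (val R) (val R)^t (val (val j)).
pose h (R : rels X Y) (j : J) := inum (val (val j)) (val R) (val R).
pose g (R S : rels X Y) (l : K) := inum (val R)^t (val S) (val (val l)).
have vJ (j : J) : vlc X (val (val j)) = k by apply: vlcX; exact: (valP j).
have vK (l : K) : vlc Y (val (val l)) = k by apply: vlcY; exact: (valP l).
(* Triangle counting on the fiber [Y]; this is the source of the divisibility of k g by the valency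
   of [R]. *)
have gl (R S : rels X Y) (l : K) : k * g R S l = vlc X (val R) * inum (val (val l)) (val S)^t (val R)^t.
  rewrite -(vK l) -(vlc_tr XY R).
  by rewrite (triangle_count fY Y0 (rtr R) (rtr S) (val l)) /= trK.
have gD (R S : rels X Y) : R != S -> inum (val R)^t (val S) (diag_set Y) = 0.
  move=> RS; have := inum_diag fY Y0 (rtr R) (rtr S); rewrite /= trK => ->.
  by rewrite (inj_eq (can_inj (@rtrK X Y))) (negbTE RS).
apply: (@thin_exists (rels X Y) J K k d (fun R : rels X Y => vlc X (val R)) h c g).
- by move: (prime_gt1 p_pr) kE; case: (k) => //; rewrite mul0n; lia.
- by rewrite /d; case: #|_| XX2 => // -[|[]].
- by rewrite /d prednK ?cXY // ltnW.
- by move=> R; apply: vlc_gt0.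
- by rewrite vlc_sum // dk.
- by move=> R j; rewrite /h /c (triangle_count fX X0 R R (val j)) vJ.
- move=> R; have := vlc_mul fX fY XY X0 R R.
  rewrite (sum_offdiag (rdiag fX)) /= (vlc_diag X0) (inum_diag fX X0) eqxx !mul1n.
  under eq_bigr => j _ do rewrite -/(c R j) vJ.
  rewrite -big_distrr /= => E.
  apply/eqP; rewrite -(eqn_add2l (vlc X (val R))) E -mulnS prednK //.
  exact: vlc_gt0.
- move=> j; have [] := prime_fiber_valencies fY XY p_pr XY1 kE (valP j) => //.
- move=> R S RS; have := vlc_mul fY fX (esym XY) Y0 (rtr R) (rtr S).
  rewrite !(vlc_tr XY) (sum_offdiag (rdiag fY)) /= trK gD // muln0 add0n => <-.
  by rewrite big_distrr; apply: eq_bigr => l _ /=; rewrite vK.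
- by move=> R S l RS; rewrite gl dvdn_mulr.
- move=> R S l RS.
  have lt : rtr (val l) \in predC1 (rdiag fY).
    rewrite inE; apply: contra (valP l) => /eqP E; apply/eqP.
    by rewrite -[LHS]rtrK E; apply: val_inj; rewrite /= tr_diag.
  (* Transposing A_R^T A_S exchanges [R] and [S] and sends l to its transpose, which turns
     divisibility on the left into divisibility on the right. *)
  pose l' : K := exist _ (rtr (val l)) lt.
  suff -> : g R S l = g S R l' by rewrite gl dvdn_mulr.
  have [x [y [_ _ xy]]] := rels_rep (val l).
  rewrite /g -(inumE (trR (relsP R)) (relsP S) (relsP (val l)) xy).
  rewrite -(inumE (u := y) (v := x) (trR (relsP S)) (relsP R) (relsP (val l'))) ?mem_tr //.
  by rewrite -{1}(trK (val S)) paths2_tr.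
(* The diagonal term is r_R r_S on the side of [X] and 0 on the side of [Y], because R and S
   differ. *)
- move=> R S RS; have := quadrangle_count fX fY XY X0 R S.
  rewrite (sum_offdiag (rdiag fX)) (sum_offdiag (rdiag fY)) /=.
  rewrite (vlc_diag X0) (vlc_diag Y0) !(inum_diag fX X0) !eqxx gD // !mul1n add0n.
  under eq_bigr => j _ do rewrite vJ.
  under [X in _ = X -> _]eq_bigr => l _ do rewrite vK.
  by rewrite -!big_distrr.
- by rewrite dk.
Qed.

End Thin.

End Configuration.

Theorem theorem1p2 (V : finType) (Rel : {set {set V * V}}) (X Y : {set V})
  (k : nat) :
  coherent_configuration Rel ->
  fiber Rel X -> fiber Rel Y -> X != Y ->
  (forall Z : {set V}, fiber Rel Z -> Z = X \/ Z = Y) ->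
  #|X| = #|Y| -> prime #|X| ->
  (2 < #|rels_between Rel X X|)%N ->
  (1 < #|rels_between Rel X Y|)%N ->
  (* k = (|X| - 1) / (|R_{X,X}| - 1) *)
  (k * (#|rels_between Rel X X| - 1) = #|X| - 1)%N ->
  [\/ (#|rels_between Rel X X|%:Z >
         (k%:Z ^+ 2 * (k%:Z + (size (primes k))%:Z - 2%:Z)))%R,
      (exists q, prime_power q /\ (k = q \/ k = 2 * q \/ k = 3 * q)%N)
    | (exists q, prime_power q /\ k = (4 * q)%N /\ ~~ (3 %| q.+1)%N)] ->
  exists2 R, R \in rels_between Rel X Y & #|R| = #|X|.
Proof.
move=> [partR _ trR cohR] fX fY _ _ XY p_pr XX2 XY1 kE cond.
have XX2' : 2 < #|{: rels Rel X X}| by rewrite card_sig.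
have XY1' : 1 < #|{: rels Rel X Y}| by rewrite card_sig.
have kE' : k * #|{: rels Rel X X}|.-1 = #|X|.-1 by rewrite card_sig -!subn1.
have [|R vR] := thin_relation partR trR cohR fX fY XY p_pr XX2' XY1' kE'.
  (* The integer inequality of the first case becomes one over the naturals, with 2 k^2 moved to the
     other side to avoid truncated subtraction. *)
  case: cond => [big|H|H]; [apply: Or31 | exact: Or32 | exact: Or33].
  rewrite prednK ?(ltn_trans _ XX2') // card_sig.
  by move: big; move: #|_| (size _) => a e; rewrite -mulnn; nia.
exists (val R); first exact: (valP R).
have [x [_ [xX _ _]]] := rels_rep partR R.
by rewrite (card_deg trR cohR R fX xX) (degE trR cohR R fX xX) vR muln1.
Qed.
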